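(* Let $\Omega,\Omega_1,\Omega_2\in L\log L(\mathbb S^{n-1})$ all satisfy the vanishing condition, i.e. each has integral zero over $\mathbb S^{n-1}$ with respect to $\sigma$. Then $$\|T_\Omega\|_{L^1\to L^{1,\infty}} \ge \frac1n\|\Omega\|_{L^1(\mathbb S^{n-1})}\quad\text{and}\quad\|T_{\vec\Omega}\|_{L^1\times L^1\to L^{1/2,\infty}}^{1/2} \ge \frac1n\|\Omega_1\Omega_2\|_{L^{1/2}(\mathbb S^{n-1})}^{1/2}.$$
   Context: $n$ is the dimension (a positive integer), $\mathbb S^{n-1}$ is the unit sphere of $\mathbb R^n$, $\sigma$ is the induced Lebesgue (surface) measure on it (counting measure if $n=1$), and $|E|$ is the Lebesgue measure of $E\subset\mathbb R^n$. All functions are real-valued. $\|\Phi\|_{L^{1/2}(\mathbb S^{n-1})}^{1/2}=\int_{\mathbb S^{n-1}}|\Phi(\theta)|^{1/2}d\sigma(\theta)$. $L\log L(\mathbb S^{n-1})$ is the set of $\Omega\in L^1(\mathbb S^{n-1})$ with $$\|\Omega\|_{L\log L(\mathbb S^{n-1})}:=\int_{\mathbb S^{n-1}}|\Omega(\theta)|\log(e+|\Omega(\theta)|)\,d\sigma(\theta)<\infty.$$ For $\Omega\in L\log L(\mathbb S^{n-1})$ with mean value zero, $T_\Omega$ is given by $$T_\Omega(f)(x)=\mathrm{p.v.}\int_{\mathbb R^n}\frac{\Omega(y/|y|)}{|y|^n}f(x-y)\,dy=\lim_{\epsilon\to0^+}\int_{|y|>\epsilon}\frac{\Omega(y/|y|)}{|y|^n}f(x-y)\,dy$$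 for $f\in C_c^\infty(\mathbb R^n)$. By known results (Seeger, Tao) it satisfies a weak-type $(1,1)$ bound $\sup_{\lambda>0}\lambda|\{|T_\Omega f|>\lambda\}|\le C_{\Omega}\|f\|_{L^1}$ on $C_c^\infty(\mathbb R^n)$. For general $f\in L^1(\mathbb R^n)$, $T_\Omega(f)$ denotes the unique continuous extension of $T_\Omega$ from the dense subspace $C_c^\infty(\mathbb R^n)$ to a linear operator $L^1(\mathbb R^n)\to L^{1,\infty}(\mathbb R^n)$. The bilinear operator is $T_{\vec\Omega}(f_1,f_2)(x)=T_{\Omega_1}(f_1)(x)\,T_{\Omega_2}(f_2)(x)$, where $\vec\Omega=(\Omega_1,\Omega_2)$. For $0<p<\infty$, $\|F\|_{L^{p,\infty}}=\sup_{\lambda>0}\lambda\,|\{x\in\mathbb R^n:|F(x)|>\lambda\}|^{1/p}$. The operator norms are $$\|T_\Omega\|_{L^1\to L^{1,\infty}}=\sup_{f\ne0}\frac{\|T_\Omega(f)\|_{L^{1,\infty}}}{\|f\|_{L^1}},\qquad \|T_{\vec\Omega}\|_{L^1\times L^1\to L^{1/2,\infty}}=\sup_{f_1,f_2\neq0}\frac{\|T_{\vec\Omega}(f_1,f_2)\|_{L^{1/2,\infty}}}{\|f_1\|_{L^1}\|f_2\|_{L^1}}.$$ *)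

(* Defs.v *)
From HB Require Import structures.
From mathcomp Require Import all_boot all_order all_algebra.
From mathcomp Require Import all_classical all_reals all_analysis.
From mathcomp Require Import measurable_realfun.

Set Implicit Arguments.
Unset Strict Implicit.
Unset Printing Implicit Defensive.

Import Order.TTheory GRing.Theory Num.Theory.
Import numFieldNormedType.Exports.

Local Open Scope classical_set_scope.
Local Open Scope ring_scope.

(* The Borel sigma-algebra of R^n, as generated by the coordinates (the same
   construction as the library's instance on n.-tuple). *)
Definition rV_display : measure_display. Proof. by constructor. Qed.

Section measurable_rV.
Context (R : realType) (n : nat).

Let coors : 'I_n -> 'rV[R]_n -> R := fun i x => x ord0 i.

Let rV_set0 : g_sigma_preimage coors set0.
Proof. exact: sigma_algebra0. Qed.

Let rV_setC A : g_sigma_preimage coors A -> g_sigma_preimage coors (~` A).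
Proof. exact: sigma_algebraC. Qed.

Let rV_bigcup (F : (set 'rV[R]_n)^nat) :
  (forall i, g_sigma_preimage coors (F i)) ->
  g_sigma_preimage coors (\bigcup_i (F i)).
Proof. exact: sigma_algebra_bigcup. Qed.

HB.instance Definition _ := @isMeasurable.Build rV_display
  'rV[R]_n (g_sigma_preimage coors) rV_set0 rV_setC rV_bigcup.

End measurable_rV.

Section measurable_rV_lemmas.
Context (R : realType).

Lemma measurable_coord n (i : 'I_n) :
  measurable_fun [set: 'rV[R]_n] (fun x : 'rV[R]_n => x ord0 i).
Proof.
move=> _ Y mY; rewrite setTI; apply: sub_sigma_algebra => /=.
rewrite -bigcup_seq/=; exists i => /=; first by rewrite mem_index_enum.
by exists Y => //; rewrite setTI.
Qed.

Lemma measurable_fun_coordP d (T : measurableType d) n (f : T -> 'rV[R]_n) :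
  (forall i, measurable_fun [set: T] (fun t => f t ord0 i)) ->
  measurable_fun [set: T] f.
Proof.
move=> mf _ A; rewrite setTI.
suff : measurable `<=` [set B : set 'rV[R]_n | measurable (f @^-1` B)].
  by apply.
apply: smallest_sub => /=.
  split => /=.
  - by rewrite preimage_set0.
  - move=> B mB; rewrite setTD preimage_setC; exact: measurableC.
  - by move=> F mF; rewrite preimage_bigcup; exact: bigcupT_measurable.
move=> B; rewrite -bigcup_seq => -[i _ [C mC <-]] /=.
rewrite setTI; have := mf i measurableT C mC; by rewrite setTI.
Qed.

End measurable_rV_lemmas.

Section euclidean.
Context (R : realType).

(* The norm that the library puts on 'rV[R]_n is the sup norm. *)
Definition enorm n (x : 'rV[R]_n) : R :=
  Num.sqrt (\sum_(i < n) (x ord0 i) ^+ 2).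

Definition direction n (x : 'rV[R]_n) : 'rV[R]_n := (enorm x)^-1 *: x.

Definition sphere n : set 'rV[R]_n := [set x | enorm x = 1].

Lemma enorm_ge0 n (x : 'rV[R]_n) : 0 <= enorm x.
Proof. exact: sqrtr_ge0. Qed.

Lemma measurable_enorm n : measurable_fun [set: 'rV[R]_n] (@enorm n).
Proof.
have mS : measurable_fun [set: 'rV[R]_n]
    (fun x : 'rV[R]_n => \sum_(i < n) (x ord0 i) ^+ 2).
  by apply: measurable_sum => i; apply: measurable_funX; exact: measurable_coord.
have : measurable_fun [set: R] (@Num.sqrt R).
  by apply: continuous_measurable_fun; exact: sqrt_continuous.
by move=> /measurableT_comp; exact.
Qed.

Lemma measurable_direction n : measurable_fun [set: 'rV[R]_n] (@direction n).
Proof.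
apply: measurable_fun_coordP => i.
rewrite (_ : (fun _ => _) = fun x => enorm x `^ (-1) * x ord0 i); last first.
  by apply/funext => x; rewrite mxE powR_inv1// enorm_ge0.
apply: measurable_funM; last exact: measurable_coord.
exact: (measurableT_comp (measurable_powR (-1))) (@measurable_enorm n).
Qed.

End euclidean.
Arguments sphere R n : clear implicits.

Section lebesgue_measure_rV.
Context (R : realType).

Definition rV_cons n (p : R * 'rV[R]_n) : 'rV[R]_n.+1 :=
  \row_(i < n.+1) if unlift ord0 i is Some j then p.2 ord0 j else p.1.

Definition rV_uncons n (v : 'rV[R]_n.+1) : R * 'rV[R]_n :=
  (v ord0 ord0, \row_i v ord0 (lift ord0 i)).

Lemma rV_consK n : cancel (@rV_cons n) (@rV_uncons n).
Proof.
move=> [x v]; rewrite /rV_uncons /rV_cons; congr (_, _).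
  by rewrite mxE unlift_none.
by apply/rowP => i; rewrite !mxE liftK.
Qed.

Lemma measurable_rV_cons n :
  measurable_fun [set: R * 'rV[R]_n] (@rV_cons n).
Proof.
apply: measurable_fun_coordP => i.
have [j ij|i0] := unliftP ord0 i.
  rewrite (_ : (fun _ => _) = (fun v : 'rV[R]_n => v ord0 j) \o snd).
    exact: measurableT_comp (measurable_coord j) measurable_snd.
  by apply/funext => -[x v]; rewrite mxE ij liftK.
rewrite (_ : (fun _ => _) = fst); first exact: measurable_fst.
by apply/funext => -[x v]; rewrite mxE i0 unlift_none.
Qed.

Lemma measurable_rV_uncons n :
  measurable_fun [set: 'rV[R]_n.+1] (@rV_uncons n).
Proof.
apply/measurable_fun_pair; first exact: measurable_coord.
apply: measurable_fun_coordP => i; rewrite (_ : (fun _ => _) =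
  fun v : 'rV[R]_n.+1 => v ord0 (lift ord0 i)); first exact: measurable_coord.
by apply/funext => v; rewrite mxE.
Qed.

Section step.
Context (n : nat) (m : {sigma_finite_measure set 'rV[R]_n -> \bar R}).

Definition leb_step : set 'rV[R]_n.+1 -> \bar R :=
  pushforward (@lebesgue_measure R \x m)%E (@rV_cons n).

Let leb_step0 : leb_step set0 = 0%E.
Proof. by rewrite /leb_step /pushforward preimage_set0 measure0. Qed.

Let leb_step_ge0 A : (0 <= leb_step A)%E.
Proof. exact: (measure_ge0 (@lebesgue_measure R \x m)%E). Qed.

Let leb_step_sigma_additive : semi_sigma_additive leb_step.
Proof.
move=> F mF tF mUF; rewrite /leb_step /pushforward preimage_bigcup.
have mp A : measurable A -> measurable (@rV_cons n @^-1` A).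
  by move=> mA; rewrite -[X in measurable X]setTI; exact: measurable_rV_cons.
apply: measure_semi_sigma_additive.
- by move=> i; exact: mp.
- apply/trivIsetP => /= i j _ _ ij; rewrite -preimage_setI.
  by move/trivIsetP : tF => /(_ _ _ _ _ ij) ->//; rewrite preimage_set0.
- by rewrite -preimage_bigcup; exact: mp.
Qed.

HB.instance Definition _ := isMeasure.Build _ _ _ leb_step
  leb_step0 leb_step_ge0 leb_step_sigma_additive.

Let leb_step_sigma_finite : sigma_finite setT leb_step.
Proof.
have /sigma_finiteP[F [TF ndF Foo]] := sigma_finiteT (@lebesgue_measure R).
have /sigma_finiteP[G [TG ndG Goo]] := sigma_finiteT m.
exists (fun k => @rV_uncons n @^-1` (F k `*` G k)).
  apply/esym/seteqP; split=> // v _.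
  have [i _ Fi] : (\bigcup_i F i) (rV_uncons v).1 by rewrite -TF.
  have [j _ Gj] : (\bigcup_i G i) (rV_uncons v).2 by rewrite -TG.
  exists (maxn i j) => //; split.
  - by move: Fi; exact/subsetPset/ndF/leq_maxl.
  - by move: Gj; exact/subsetPset/ndG/leq_maxr.
move=> k; have [mF Fk] := Foo k; have [mG Gk] := Goo k; split.
  rewrite -[X in measurable X]setTI; apply: measurable_rV_uncons => //.
  exact: measurableX.
rewrite /leb_step /pushforward -comp_preimage (_ : _ \o _ = id); last first.
  by apply/funext => p /=; rewrite rV_consK.
by rewrite preimage_id product_measure1E// lte_mul_pinfty// ge0_fin_numE.
Qed.

HB.instance Definition _ := Measure_isSigmaFinite.Build _ _ _ leb_step
  leb_step_sigma_finite.

End step.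

(* |E| for E a Borel subset of R^n: the iterated product of the Lebesgue
   measure of the line, see [leb_box]. *)
Fixpoint leb (n : nat) : {sigma_finite_measure set 'rV[R]_n -> \bar R} :=
  if n is k.+1 then leb_step (leb k) else \d_(0 : 'rV[R]_0).

Lemma leb_box n (A : 'I_n -> set R) : (forall i, measurable (A i)) ->
  leb n [set x : 'rV[R]_n | forall i, A i (x ord0 i)] =
    (\prod_(i < n) lebesgue_measure (A i))%E.
Proof.
elim: n A => [|n IH] A mA.
  by rewrite big_ord0 /= diracE mem_set// => -[].
rewrite big_ord_recl -IH//=.
have mB : measurable [set x : 'rV[R]_n | forall i, A (lift ord0 i) (x ord0 i)].
  rewrite (_ : [set _ | _] = \bigcap_(i in [set: 'I_n])
      ((fun x : 'rV[R]_n => x ord0 i) @^-1` A (lift ord0 i))); last first.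
    by apply/seteqP; split => x /= h i; [move=> _; exact: h|exact: (h i I)].
  apply: fin_bigcap_measurable => // i _.
  by rewrite -[X in measurable X]setTI; exact: measurable_coord.
have mA0 := mA ord0.
rewrite /leb_step /pushforward -product_measure1E//; congr (product_measure1 _ _ _).
apply/seteqP; split => -[x v] /=.
  move=> h; split => [|i /=]; first by have := h ord0; rewrite mxE unlift_none.
  by have := h (lift ord0 i); rewrite mxE liftK.
move=> [h1 h2] i; rewrite mxE.
by case: unliftP => [j|] ->; [exact: h2|].
Qed.

End lebesgue_measure_rV.

Section surface_measure.
Context (R : realType) (n : nat).
Local Open Scope ereal_scope.

(* The surface measure of S^{n-1}, as the measure on R^n that it induces, by
   the classical formula sigma(A) = n |{r theta : 0 < r < 1, theta in A}|; this
   is the measure for which integration in polar coordinates reads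
   dx = r^{n-1} dr dsigma(theta), and the counting measure of {-1, 1} when
   n = 1. *)
Definition sigma (A : set 'rV[R]_n) : \bar R :=
  n%:R%:E * leb R n [set x | (0 < enorm x < 1)%R /\ A (direction x)].

Let pball : set 'rV[R]_n := [set x | (0 < enorm x < 1)%R].

Let measurable_pball : measurable pball.
Proof.
rewrite (_ : pball = @enorm R n @^-1` `]0%R, 1%R[%classic); last first.
  by apply/seteqP; split => x /=; rewrite in_itv.
by rewrite -[X in measurable X]setTI; exact: measurable_enorm.
Qed.

Let sigmaE A :
  sigma A = n%:R%:E * leb R n (pball `&` @direction R n @^-1` A).
Proof. by []. Qed.

Let sigma0 : sigma set0 = 0.
Proof. by rewrite sigmaE preimage_set0 setI0 measure0 mule0. Qed.

Let sigma_ge0 A : 0 <= sigma A.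
Proof. by rewrite sigmaE mule_ge0// lee_fin. Qed.

Let sigma_sigma_additive : semi_sigma_additive sigma.
Proof.
move=> F mF tF mUF; rewrite sigmaE preimage_bigcup setI_bigcupr.
have mp A : measurable A -> measurable (pball `&` @direction R n @^-1` A).
  move=> mA; apply: measurableI => //.
  by rewrite -[X in measurable X]setTI; exact: measurable_direction.
rewrite (_ : (fun k => _) = (fun k => n%:R%:E *
    \sum_(0 <= i < k) leb R n (pball `&` @direction R n @^-1` F i))).
  apply: cvgeZl => //; apply: measure_semi_sigma_additive.
  - by move=> i; exact: mp.
  - apply/trivIsetP => /= i j _ _ ij; rewrite setIACA -preimage_setI.
    by move/trivIsetP : tF => /(_ _ _ _ _ ij) ->//; rewrite preimage_set0 setI0.
  - by apply: bigcupT_measurable => i; exact: mp.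
by apply/funext => k; rewrite ge0_sume_distrr.
Qed.

HB.instance Definition _ := isMeasure.Build _ _ _ sigma
  sigma0 sigma_ge0 sigma_sigma_additive.

End surface_measure.
Arguments sigma R n : clear implicits.

Section function_spaces.
Context (R : realType) (n : nat).
Implicit Types (f F Phi Omega : 'rV[R]_n -> R).

Fixpoint is_Ck (k : nat) (f : 'rV[R]_n -> R) : Prop :=
  continuous f /\
  (if k is k'.+1 then
     forall i : 'I_n, (forall x, derivable f x (delta_mx ord0 i)) /\
       is_Ck k' ('D_(delta_mx ord0 i) f)
   else True).

Definition Cc_infty : set ('rV[R]_n -> R) :=
  [set f | (forall k, is_Ck k f) /\ compact (closure [set x | f x != 0])].

Definition L1 : set ('rV[R]_n -> R) :=
  [set f | (leb R n).-integrable setT (EFin \o f)].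

Definition L1norm f : \bar R := (\int[leb R n]_x `|f x|%:E)%E.

Definition weak_norm (p : R) F : \bar R :=
  ereal_sup [set (lam%:E * (leb R n [set x | (lam < `|F x|)%R]) `^ p^-1)%E
            | lam in [set lam : R | 0 < lam]].

Definition sphere_L1norm Omega : \bar R :=
  (\int[sigma R n]_(t in sphere R n) `|Omega t|%:E)%E.

(* The power 1/2 of the L^{1/2} quasi-norm. *)
Definition sphere_Lhalf Phi : \bar R :=
  (\int[sigma R n]_(t in sphere R n) (`|Phi t| `^ 2^-1)%:E)%E.

Definition LlogL_norm Omega : \bar R :=
  (\int[sigma R n]_(t in sphere R n)
     (`|Omega t| * ln (expR 1 + `|Omega t|))%:E)%E.

(* Only the values of Omega on the sphere matter. *)
Definition LlogL : set ('rV[R]_n -> R) :=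
  [set Omega | (sigma R n).-integrable (sphere R n) (EFin \o Omega) /\
               (LlogL_norm Omega < +oo)%E].

Definition mean_zero Omega : Prop :=
  (\int[sigma R n]_(t in sphere R n) (Omega t)%:E = 0)%E.

End function_spaces.

Section singular_integrals.
Context (R : realType) (n : nat).
Notation V := 'rV[R]_n.
Implicit Types (f g Omega : V -> R) (T : (V -> R) -> V -> R).

Definition truncated Omega (eps : R) f (x : V) : R :=
  \int[leb R n]_(y in [set y : V | eps < enorm y])
     (Omega (direction y) / enorm y ^+ n * f (x - y)).

Definition pv Omega f (x : V) : R :=
  lim (truncated Omega eps f x @[eps --> 0^'+]).

(* T is a linear operator L^1 -> L^{1,oo} (on representatives, identities
   being almost everywhere), continuous for the corresponding (quasi-)norms
   and given by the principal value on C_c^oo. *)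
Record continuous_extension Omega T : Prop := {
  ext_measurable : forall f, L1 f -> measurable_fun [set: V] (T f) ;
  ext_weak : forall f, L1 f -> (weak_norm 1 (T f) < +oo)%E ;
  ext_linear : forall (a : R) f g, L1 f -> L1 g ->
    \forall x \ae leb R n,
      T (fun z => a * f z + g z) x = a * T f x + T g x ;
  ext_continuous : forall (u : nat -> V -> R) f,
    (forall k, L1 (u k)) -> L1 f ->
    L1norm (fun x => u k x - f x) @[k --> \oo] --> 0%E ->
    weak_norm 1 (fun x => T (u k) x - T f x) @[k --> \oo] --> 0%E ;
  ext_pv : forall f, Cc_infty f ->
    \forall x \ae leb R n, T f x = pv Omega f x }.

(* For Omega in L log L with mean zero an extension exists (weak type (1,1)
   bound of Seeger and Tao) and is unique up to almost everywhere equality; the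
   default value of [xget] is then irrelevant. *)
Definition T_Omega Omega : (V -> R) -> V -> R :=
  xget (pv Omega) [set T | continuous_extension Omega T].

Definition T_vec Omega1 Omega2 f1 f2 (x : V) : R :=
  T_Omega Omega1 f1 x * T_Omega Omega2 f2 x.

Definition nonzero_L1 : set (V -> R) :=
  [set f | L1 f /\ L1norm f != 0%E].

Definition op_norm T : \bar R :=
  ereal_sup [set (weak_norm 1 (T f) / L1norm f)%E | f in nonzero_L1].

Definition op_norm2 (B : (V -> R) -> (V -> R) -> V -> R) : \bar R :=
  ereal_sup [set (weak_norm 2^-1 (B f1 f2) / (L1norm f1 * L1norm f2))%E
            | f1 in nonzero_L1 & f2 in nonzero_L1].

End singular_integrals.

(* Main.v *)
Require Import Defs.
From HB Require Import structures.
From mathcomp Require Import all_boot all_order all_algebra.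
From mathcomp Require Import all_classical all_reals all_analysis.
From mathcomp Require Import measurable_realfun.
From mathcomp Require Import lra.
Set Implicit Arguments.
Unset Strict Implicit.
Unset Printing Implicit Defensive.
Import Order.TTheory GRing.Theory Num.Theory.
Import numFieldNormedType.Exports.
Local Open Scope classical_set_scope.
Local Open Scope ring_scope.

(** Test the operators on smooth even bumps [f >= 0] of integral one supported in
a small ball of radius [d].  Away from the support, the principal value is an
honest convolution, so on a shell [a < |x| < b] the function [T_Omega f] is an
average of the kernel [K x = Omega (x / |x|) / |x|^n]; as [d] tends to [0] it
converges to [K] in measure there, because Lipschitz functions are dense in
[L^1] of the shell.  Hence the weak norms dominate the measures of
[{|K| > 1}] and [{|K1 K2| > 1}], which in polar coordinates are
[1/n int |Omega|] and [1/n int |Omega1 Omega2|^(1/2)].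

Only test functions in [C_c^oo] are used, where [T_Omega] agrees almost
everywhere with the principal value whether or not a continuous extension
exists, so the weak type (1,1) theorem is not needed; and since [leb] is
monotone on all sets, neither is the measurability of [T_Omega f].  The first
bound is the second argument with [Omega1 = Omega2 = Omega]. *)

(** * Lebesgue measure *)

Section leb_sets.
Context (R : realType).

(* No measurability is needed: the integral of a nonnegative function is a
   supremum over simple functions. *)
Lemma ge0_le_integral_sup d (T : measurableType d) (mu : {measure set T -> \bar R})
    (D : set T) (f g : T -> \bar R) :
  (forall x, D x -> 0 <= f x)%E -> (forall x, D x -> f x <= g x)%E ->
  (\int[mu]_(x in D) f x <= \int[mu]_(x in D) g x)%E.
Proof.
move=> f0 fg; rewrite !ge0_integralE//; last first.
  by move=> x Dx; rewrite (le_trans (f0 _ Dx))// fg.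
apply: le_ereal_sup => _ [h /= hf <-]; exists h => //= x.
apply: le_trans (hf x) _; rewrite !patchE; case: ifPn => // /set_mem; exact: fg.
Qed.

(** Change of variables for a measure that is a multiple of an image measure. It serves three times:
    for dilations of the line, for translations of R^n, and for [direction], which carries Lebesgue
    measure on a punctured ball to a multiple of [sigma]. *)
Lemma ge0_integral_scaled_image d1 d2 (X : measurableType d1)
    (Y : measurableType d2) (phi : X -> Y) (mu : {measure set X -> \bar R})
    (nu : {measure set Y -> \bar R}) (c : {nonneg R}) :
  measurable_fun setT phi ->
  (forall A, measurable A -> nu A = (c%:num%:E * mu (phi @^-1` A))%E) ->
  forall f : Y -> \bar R, measurable_fun setT f -> (forall y, 0 <= f y)%E ->
  (\int[nu]_y f y = c%:num%:E * \int[mu]_x f (phi x))%E.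
Proof.
move=> mphi nuE f mf f0.
pose p : {mfun X >-> Y} := HB.pack phi (isMeasurableFun.Build _ _ _ _ _ mphi).
rewrite (eq_measure_integral (mscale c (pushforward mu p))).
  rewrite ge0_integral_mscale//; congr (_ * _)%E.
  by rewrite ge0_integral_pushforward.
by move=> A mA _; exact: nuE.
Qed.

(** Allows results about integrals over the whole space, such as the density of Lipschitz functions
    for a finite measure, to be applied on a shell. *)
Lemma ge0_integral_mrestr d (T : measurableType d) (mu : {measure set T -> \bar R})
    (D : set T) (mD : measurable D) (f : T -> \bar R) :
  measurable_fun setT f -> (forall x, 0 <= f x)%E ->
  (\int[mrestr mu mD]_x f x = \int[mu]_(x in D) f x)%E.
Proof.
move=> mf f0.
rewrite (@ge0_negligible_integral _ _ _ (mrestr mu mD) setT (~` D))//; last 2 first.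
- exact: measurableC.
- by rewrite /= /mrestr setICl measure0.
rewrite setTD setCK; apply: eq_measure_integral => A mA AD.
by rewrite /= /mrestr setIidl.
Qed.

(** The sets {|T_Omega f| > 1} are compared through this lemma, so it covers arbitrary sets. By
    induction on the dimension: the product measure integrates the measures of the sections, and
    that integral is monotone as a supremum. *)
Lemma leb_le n (A B : set 'rV[R]_n) : A `<=` B -> (leb R n A <= leb R n B)%E.
Proof.
elim: n A B => [|n IH] A B AB /=.
  rewrite !diracE lee_fin ler_nat.
  case: (boolP (_ \in A)) => // /set_mem/AB; by move=> /mem_set ->.
rewrite /leb_step /pushforward /product_measure1 /=.
apply: ge0_le_integral_sup => // x _; apply: IH => v /=.
by rewrite /xsection /= !inE; exact: AB.
Qed.

End leb_sets.

(** * Affine changes of variable *)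

Section affine.
Context (R : realType).
Variables (t : R) (t0 : 0 < t).

Let aff (y s : R) := t * s + y.

Let measurable_aff y : measurable_fun [set: R] (aff y).
Proof. by apply: measurable_funD => //; exact: measurable_funM. Qed.

Let tnn : {nonneg R} := NngNum (ltW t0).

Let lebesgue_measure_aff y (A : set R) : measurable A ->
  lebesgue_measure A = (t%:E * lebesgue_measure (aff y @^-1` A))%E.
Proof.
move=> mA.
pose nu : {measure set (measurableTypeR R) -> \bar R} :=
  pushforward (@lebesgue_measure R) (aff y : _ -> measurableTypeR R).
transitivity (mscale tnn (nu (measurable_aff y)) A); last by [].
(* By uniqueness of Lebesgue measure, only half-open intervals have to be checked. *)
apply: lebesgue_measure_unique => // X [[a b] /= _ <-].
rewrite /mscale/= /nu /pushforward lebesgue_measure_itv /=.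
rewrite (_ : aff y @^-1` _ = `](a - y) / t, (b - y) / t]%classic); last first.
  apply/seteqP; split => s /=; rewrite !in_itv/= /aff ltr_pdivrMr// ler_pdivlMr//.
    by rewrite ltrBlDr lerBrDr ![s * t]mulrC.
  by rewrite ltrBlDr lerBrDr ![s * t]mulrC.
rewrite lebesgue_measure_itv/= !lte_fin ltr_pdivrMr// divfK ?gt_eqF// ltrD2r.
case: ifP => ab; last by rewrite mule0.
rewrite !EFinN -!EFinB -EFinM; congr EFin.
by rewrite -mulrBl mulrC divfK ?gt_eqF// opprB addrA subrK.
Qed.

(** One factor [t] per coordinate: the line formula treats the first coordinate and the induction
    hypothesis each section. *)
Lemma leb_affine n (y : 'rV[R]_n) (A : set 'rV[R]_n) : measurable A ->
  leb R n A = ((t ^+ n)%:E * leb R n [set x | A (t *: x + y)%R])%E.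
Proof.
elim: n y A => [|n IH] y A mA.
  rewrite expr0 mul1e; congr (leb R 0 _); apply/seteqP.
  by split => x /=; rewrite (_ : t *: x + y = x)//; apply/rowP => -[].
rewrite /= /leb_step /pushforward /product_measure1.
set B := @rV_cons R n @^-1` A.
have mB : measurable B.
  by rewrite -[X in measurable X]setTI; exact: measurable_rV_cons.
have mf := measurable_fun_xsection (leb R n) mB.
rewrite (@ge0_integral_scaled_image R _ _ (measurableTypeR R) (measurableTypeR R)
  (aff (y ord0 ord0)) lebesgue_measure lebesgue_measure tnn)//=; first last.
- exact: lebesgue_measure_aff.
- exact: measurable_aff.
  rewrite exprS EFinM -muleA; congr (_ * _)%E.
  rewrite -ge0_integralZl//; first last.
  - by rewrite lee_fin exprn_ge0// ltW.
  - apply: measurable_fun_xsection.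
    rewrite -[X in measurable X]setTI.
    apply: (@measurable_rV_cons R n) => //.
    rewrite -[X in measurable X]setTI.
    have : measurable_fun setT (fun x : 'rV[R]_n.+1 => t *: x + y).
      apply: measurable_fun_coordP => i.
      rewrite (_ : (fun _ => _) = fun x : 'rV[R]_n.+1 => t * x ord0 i + y ord0 i).
        apply: measurable_funD => //; apply: measurable_funM => //.
        exact: measurable_coord.
      by apply/funext => x; rewrite !mxE.
    by apply.
  apply: eq_integral => s _ /=.
  rewrite (IH (\row_i y ord0 (lift ord0 i))).
    congr (_ * leb R n _)%E; apply/seteqP; split => v /=;
      rewrite /xsection /= !inE /B /=;
      congr (A _); apply/rowP => i; rewrite !mxE; case: unliftP => [j|] ->;
      by rewrite ?mxE.
  by have := measurable_xsection (aff (y ord0 ord0) s) mB.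
Qed.

End affine.

Section translation.
Context (R : realType) (n : nat).

Lemma measurable_shift (y : 'rV[R]_n) :
  measurable_fun setT (fun x : 'rV[R]_n => x - y).
Proof.
apply: measurable_fun_coordP => i.
rewrite (_ : (fun _ => _) = fun x : 'rV[R]_n => x ord0 i - y ord0 i).
  by apply: measurable_funB => //; exact: measurable_coord.
by apply/funext => x; rewrite !mxE.
Qed.

Lemma ge0_integral_shift (y : 'rV[R]_n) (f : 'rV[R]_n -> \bar R) :
  measurable_fun setT f -> (forall x, 0 <= f x)%E ->
  (\int[leb R n]_x f (x - y)%R = \int[leb R n]_x f x)%E.
Proof.
move=> mf f0; have ms := measurable_shift y.
rewrite [RHS](ge0_integral_scaled_image (mu := leb R n) (c := 1%:nng) ms _ mf f0)
  ?mul1e//.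
move=> A mA; apply: (etrans (leb_affine ltr01 (- y) mA)); rewrite expr1n.
congr (1%:E * leb R n _)%E.
by apply/seteqP; split => x /=; rewrite scale1r.
Qed.

End translation.

(** * Polar coordinates *)

Section polar.
Import HBNNSimple.
Context (R : realType) (n : nat) (n_gt0 : (0 < n)%N).
Local Notation V := 'rV[R]_n.

Lemma enormZ (t : R) (x : V) : 0 <= t -> enorm (t *: x) = t * enorm x.
Proof.
move=> t0; rewrite /enorm.
under eq_bigr do rewrite mxE exprMn.
by rewrite -mulr_sumr sqrtrM ?sqr_ge0// sqrtr_sqr ger0_norm.
Qed.

Lemma directionZ (t : R) (x : V) : 0 < t -> direction (t *: x) = direction x.
Proof.
move=> t0; rewrite /direction enormZ ?ltW// invfM scalerA -mulrA.
by rewrite [_ * t]mulrC mulrA mulVf ?gt_eqF// mul1r.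
Qed.

Lemma sphere_direction (x : V) : 0 < enorm x -> sphere R n (direction x).
Proof.
move=> x0; rewrite /sphere/= /direction enormZ ?invr_ge0 ?ltW//.
by rewrite mulVf ?gt_eqF.
Qed.

Lemma measurable_sphere : measurable (sphere R n).
Proof.
rewrite (_ : sphere R n = @enorm R n @^-1` [set 1]); last by [].
by rewrite -[X in measurable X]setTI; exact: measurable_enorm.
Qed.

Lemma measurable_shell (a b : R) : measurable [set x : V | a < enorm x < b].
Proof.
rewrite (_ : [set _ | _] = @enorm R n @^-1` `]a, b[%classic); last first.
  by apply/seteqP; split => x /=; rewrite in_itv.
by rewrite -[X in measurable X]setTI; exact: measurable_enorm.
Qed.

Definition cone (r : R) (A : set V) : set V :=
  [set x | 0 < enorm x < r /\ A (direction x)].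

Lemma measurable_cone r A : measurable A -> measurable (cone r A).
Proof.
move=> mA; apply: (@measurableI _ _ [set x : V | 0 < enorm x < r]
  (@direction R n @^-1` A)); first exact: measurable_shell.
by rewrite -[X in measurable X]setTI; exact: measurable_direction.
Qed.

(** The cone of radius [r] is the dilate by [r] of the one of radius 1, whose measure defines
    [sigma]; dilations preserve directions. *)
Lemma leb_cone r A : 0 < r -> measurable A ->
  (n%:R%:E * leb R n (cone r A) = (r ^+ n)%:E * sigma R n A)%E.
Proof.
move=> r0 mA; rewrite (leb_affine r0 0 (measurable_cone r mA)).
rewrite muleCA; congr (_ * (_ * leb R n _))%E.
apply/seteqP; split => x /=; rewrite /cone/= addr0 enormZ ?ltW// directionZ//;
by rewrite pmulr_rgt0// -ltr_pdivlMl// mulVf ?gt_eqF.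
Qed.

Lemma ge0_integral_cone r (g : V -> \bar R) : 0 < r ->
  measurable_fun setT g -> (forall x, 0 <= g x)%E ->
  ((r ^+ n)%:E * \int[sigma R n]_x g x =
   n%:R%:E * \int[leb R n]_(x in [set x : V | (0 < enorm x < r)%R]) g (direction x))%E.
Proof.
move=> r0 mg g0.
have nz : n%:R != 0 :> R by rewrite pnatr_eq0 -lt0n.
have rn0 : 0 < r ^+ n by rewrite exprn_gt0.
have c0 : 0 <= n%:R / r ^+ n by rewrite divr_ge0// ltW.
have mD := measurable_shell 0 r.
have md := @measurable_direction R n.
rewrite -(@ge0_integral_mrestr R _ _ (leb R n) _ mD (fun x => g (direction x)))//;
  last exact: measurableT_comp.
rewrite (@ge0_integral_scaled_image R _ _ _ _ _ (mrestr (leb R n) mD) _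
  (NngNum c0) md)//=.
  by rewrite muleA -EFinM mulrC divfK ?gt_eqF.
move=> A mA; rewrite /mrestr setIC.
have := leb_cone r0 mA.
rewrite EFinM muleAC => ->.
by rewrite muleAC -EFinM divff ?gt_eqF// mul1e.
Qed.

(** In the direction theta the set on the right is the segment of length g(theta)^(1/n), which
    contributes g(theta)/n. The integral is a supremum over simple functions h <= g, and for such an
    h the set splits into disjoint cones of radius c^(1/n) over the level sets {h = c}. *)
Lemma polar_lower_bound (g : V -> R) : (forall x, 0 <= g x) ->
  (n%:R^-1%:E * \int[sigma R n]_(x in sphere R n) (g x)%:E <=
   leb R n [set x : V | (0 < enorm x)%R /\ (enorm x ^+ n < g (direction x))%R])%E.
Proof.
move=> g0; have nz : n%:R != 0 :> R by rewrite pnatr_eq0 -lt0n.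
rewrite ge0_integralE; last by move=> x _; rewrite lee_fin.
have n0 : 0 < n%:R :> R by rewrite ltr0n.
rewrite lee_pdivrMl//; apply: ge_ereal_sup => _ [h hg <-].
rewrite -lee_pdivrMl//.
rewrite sintegralE ge0_mule_fsumr; last first.
  move=> c; have [c0|c0] := leP 0 c; first by rewrite mule_ge0// lee_fin.
  rewrite preimage10 ?measure0 ?mule0//.
  by move=> [x _ xc]; move: c0; rewrite ltNge -xc fun_ge0.
pose B (c : R) := [set x : V | [/\ 0 < enorm x, enorm x ^+ n < c &
  h (direction x) = c]].
have cE (c : R) : 0 <= c -> (c `^ n%:R^-1) ^+ n = c.
  by move=> c0; rewrite -powR_mulrn ?powR_ge0// -powRrM mulVf// powRr1.
have BE c : 0 < c -> B c = cone (c `^ n%:R^-1) (h @^-1` [set c]).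
  move=> c0; apply/seteqP; split => x; rewrite /B /cone /=.
    move=> [x0 xc hc]; split=> //; rewrite x0/=.
    by rewrite -(@ltr_pXn2r _ n)// ?nnegrE ?enorm_ge0 ?powR_ge0// cE// ltW.
  move=> [/andP[x0 xc] hc]; split=> //.
  by rewrite -(cE _ (ltW c0)) ltr_pXn2r// ?nnegrE ?enorm_ge0 ?powR_ge0.
have B0 c : c <= 0 -> B c = set0.
  move=> c0; apply/seteqP; split => x //= [x0 xc _].
  by have := lt_le_trans xc c0; rewrite ltNge exprn_ge0// enorm_ge0.
have mB c : measurable (B c).
  have [c0|c0] := leP c 0; first by rewrite B0.
  by rewrite BE//; exact: measurable_cone.
(* Each term c sigma(h = c) / n is the measure of the cone [B c]; these cones are disjoint and lie
   in the target set. *)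
rewrite (_ : (\sum_(i \in _) _)%E = (\sum_(c \in range h) leb R n (B c))%E).
  rewrite -measure_fin_bigcup//; last first.
    apply/trivIsetP => c d _ _ cd; apply/seteqP; split => // x /=.
    by move=> [[_ _ hc] [_ _ hd]]; move: cd; rewrite -hc hd eqxx.
  apply: leb_le => x [c _ [x0 xc hc]]; split => //; apply: lt_le_trans xc _.
  have := hg (direction x); rewrite patchE mem_set ?hc ?lee_fin//.
  exact: sphere_direction.
apply: eq_fsbigr => c /set_mem[x _ hx].
(* As h >= 0, a value c <= 0 is 0, and then both terms vanish. *)
have [c0|c0] := leP c 0.
  have -> : c = 0 by apply/eqP; rewrite eq_le c0 -hx/=.
  by rewrite mul0e mule0 B0// measure0.
rewrite BE//.
have := leb_cone (powR_gt0 n%:R^-1 c0) (measurable_funPTI h (measurable_set1 c)).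
rewrite cE ?ltW// => <-.
by rewrite muleA -EFinM mulVf// mul1e.
Qed.

End polar.

(** * Density of Lipschitz functions *)

Section lipschitz_density.
Context (R : realType) (n : nat).
Local Notation V := 'rV[R]_n.

Definition lip (f : V -> R) := measurable_fun setT f /\
  exists2 L : R, 0 <= L & forall x y, `|f x - f y| <= L * enorm (x - y).

Definition L1dist (mu : {measure set V -> \bar R}) (f g : V -> R) : \bar R :=
  (\int[mu]_x `|f x - g x|%:E)%E.

Lemma coord_le_enorm (x : V) i : `|x ord0 i| <= enorm x.
Proof.
rewrite -sqrtr_sqr; apply: ler_wsqrtr; rewrite (bigD1 i)//= lerDl.
by apply: sumr_ge0 => j _; exact: sqr_ge0.
Qed.

Lemma lip_cst c : lip (cst c).
Proof.
by split => //; exists 0 => // x y; rewrite subrr normr0 mul0r.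
Qed.

Lemma lipD f g : lip f -> lip g -> lip (f \+ g).
Proof.
move=> [mf [L L0 fL]] [mg [M M0 gM]]; split; first exact: measurable_funD.
exists (L + M); first exact: addr_ge0.
move=> x y; rewrite /= opprD addrACA mulrDl.
by apply: le_trans (ler_normD _ _) _; exact: lerD (fL _ _) (gM _ _).
Qed.

Lemma lipZ c f : lip f -> lip (fun x => c * f x).
Proof.
move=> [mf [L L0 fL]]; split; first exact: measurable_funM.
exists (`|c| * L); first by rewrite mulr_ge0.
by move=> x y; rewrite -mulrBr normrM -mulrA ler_wpM2l.
Qed.

(** Lipschitz functions are stable under products only when bounded; this is why [lip_set] asks for
    approximants with values in [0, 1]. *)
Lemma lipM01 f g : (forall x, 0 <= f x <= 1) -> (forall x, 0 <= g x <= 1) ->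
  lip f -> lip g -> lip (f \* g).
Proof.
move=> f01 g01 [mf [L L0 fL]] [mg [M M0 gM]]; split; first exact: measurable_funM.
exists (L + M); first exact: addr_ge0.
move=> x y /=.
have -> : f x * g x - f y * g y = (f x - f y) * g x + f y * (g x - g y) by lra.
apply: le_trans (ler_normD _ _) _; rewrite [leRHS]mulrDl; apply: lerD.
  rewrite normrM; apply: le_trans (fL x y); rewrite ler_piMr//.
  by have /andP[g0 g1] := g01 x; rewrite ger0_norm.
rewrite normrM; apply: le_trans (gM x y); rewrite ler_piMl//.
by have /andP[f0 f1] := f01 y; rewrite ger0_norm.
Qed.

Variable mu : {measure set V -> \bar R}.

Lemma measurable_abs_sub (f g : V -> R) (D : set V) :
  measurable_fun setT f -> measurable_fun setT g ->
  measurable_fun D (fun x => `|f x - g x|%:E).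
Proof.
move=> mf mg; apply: measurable_funTS; apply/measurable_EFinP.
by apply: measurableT_comp => //; exact: measurable_funB.
Qed.

Lemma L1dist_tri f g h : measurable_fun setT f -> measurable_fun setT g ->
  measurable_fun setT h -> (L1dist mu f h <= L1dist mu f g + L1dist mu g h)%E.
Proof.
move=> mf mg mh; rewrite /L1dist -ge0_integralD//; [|exact: measurable_abs_sub..].
apply: ge0_le_integral_sup => x _; first by rewrite lee_fin.
by rewrite -EFinD lee_fin; exact: ler_distD.
Qed.

Hypothesis mufin : (mu setT < +oo)%E.

Let mu_lty A : measurable A -> (mu A < +oo)%E.
Proof.
by move=> mA; apply: le_lt_trans mufin; apply: le_measure; rewrite ?inE.
Qed.

(** The sets with this property form a sigma-algebra: complements come from 1 - f, intersections
    from products, countable unions from the finiteness of [mu]. It contains the coordinate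
    half-spaces, hence every Borel set. *)
Definition lip_set (A : set V) := measurable A /\
  forall e : R, 0 < e -> exists f, [/\ forall x, 0 <= f x <= 1, lip f &
    (L1dist mu f \1_A <= e%:E)%E].

Let lip_set0 : lip_set set0.
Proof.
split => // e e0; exists (cst 0); split.
- by move=> x; rewrite lexx ler01.
- exact: lip_cst.
- rewrite /L1dist integral0_eq ?lee_fin ?ltW// => x _.
  by rewrite indic0 /= subr0 normr0.
Qed.

Let lip_setC A : lip_set A -> lip_set (~` A).
Proof.
move=> [mA Ae]; split; first exact: measurableC.
move=> e /Ae[f [f01 fl fA]]; exists (cst 1 \+ (fun x => -1 * f x)); split.
- by move=> x /=; have := f01 x; lra.
- by apply: lipD; [exact: lip_cst|exact: lipZ].
- rewrite (_ : L1dist _ _ _ = L1dist mu f \1_A)//; apply: eq_integral => x _.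
  rewrite /= !indicE in_setC -normrN; congr (`|_|%:E).
  by case: (x \in A) => /=; lra.
Qed.

Let lip_setI A B : lip_set A -> lip_set B -> lip_set (A `&` B).
Proof.
move=> [mA Ae] [mB Be]; split; first exact: measurableI.
move=> e e0; have e20 : 0 < e / 2 by rewrite divr_gt0.
have [f [f01 fl fA]] := Ae _ e20; have [g [g01 gl gB]] := Be _ e20.
exists (f \* g); split.
- move=> x /=; have /andP[f0 f1] := f01 x; have /andP[g0 g1] := g01 x.
  by rewrite mulr_ge0//= mulr_ile1.
- exact: lipM01.
- rewrite (splitr e) EFinD; apply: le_trans (leeD fA gB).
  rewrite /L1dist -ge0_integralD//; last 2 first.
  + by apply: measurable_abs_sub => //; exact: fl.1.
  + by apply: measurable_abs_sub => //; exact: gl.1.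
  apply: ge0_le_integral_sup => x _; first by rewrite lee_fin.
  rewrite -EFinD lee_fin /= indicI /=.
  have -> : f x * g x - \1_A x * \1_B x =
    (f x - \1_A x) * g x + \1_A x * (g x - \1_B x) by lra.
  apply: le_trans (ler_normD _ _) _; apply: lerD; rewrite normrM.
    by rewrite ler_piMr//; have /andP[g0 g1] := g01 x; rewrite ger0_norm.
  by rewrite ler_piMl// indicE; case: (_ \in _); rewrite ?normr1 ?normr0.
Qed.

Let lip_setU A B : lip_set A -> lip_set B -> lip_set (A `|` B).
Proof.
move=> lA lB; rewrite -[_ `|` _]setCK setCU.
by apply: lip_setC; apply: lip_setI; exact: lip_setC.
Qed.

Let lip_set_bigcup (F : (set V)^nat) : (forall i, lip_set (F i)) ->
  lip_set (\bigcup_i F i).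
Proof.
move=> lF; have mF i : measurable (F i) by have [] := lF i.
split; first exact: bigcupT_measurable.
move=> e e0; have e20 : 0 < e / 2 by rewrite divr_gt0.
set U := \bigcup_i F i; have mU : measurable U by exact: bigcupT_measurable.
pose G k := \big[setU/set0]_(i < k) F i.
have lG k : lip_set (G k).
  rewrite /G; elim: k => [|k IH]; first by rewrite big_ord0.
  by rewrite big_ord_recr; exact: lip_setU.
have mG k : measurable (G k) by have [] := lG k.
have GU k : G k `<=` U by rewrite /G -bigcup_mkord => x [j _ Fj]; exists j.
(* The finite unions [G k] exhaust [U], so what they miss has measure tending to 0. This costs e/2,
   and the approximation of [G k] the other e/2. *)
have : mu (U `\` G k) @[k --> \oo] --> mu (\bigcap_k (U `\` G k)).
  apply: (nonincreasing_cvg_mu (F := fun k => U `\` G k)).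
  - by apply: mu_lty; exact: measurableD.
  - by move=> k; exact: measurableD.
  - by apply: bigcapT_measurable => k; exact: measurableD.
  - move=> k l kl; apply/subsetPset => x [Ux Gx]; split => //; apply: contra_not Gx.
    by rewrite /G -!bigcup_mkord => -[j jk Fj]; exists j => //=; exact: leq_trans kl.
rewrite (_ : \bigcap_k _ = set0) ?measure0; last first.
  apply/seteqP; split => // x h.
  have [[i _ Fi] _] := h 0%N I.
  have [_] := h i.+1 I; apply; rewrite /G big_ord_recr/=; by right.
move=> /fine_cvgP[_]/cvgrPdist_le => /(_ _ e20)[k _ /(_ k (leqnn k))] /=.
have fin : mu (U `\` G k) \is a fin_num.
  by rewrite ge0_fin_numE//; apply: mu_lty; exact: measurableD.
rewrite sub0r normrN ger0_norm ?fine_ge0// => Uk.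
have [f [f01 fl fG]] := (lG k).2 _ e20.
exists f; split => //.
have mi A : measurable A -> measurable_fun setT (\1_A : V -> R) by [].
apply: le_trans (L1dist_tri fl.1 (mi _ (mG k)) (mi _ mU)) _.
rewrite (splitr e) EFinD; apply: leeD => //.
apply: (@le_trans _ _ (mu (U `\` G k))); last by rewrite -(fineK fin) lee_fin.
rewrite /L1dist -(setIT (U `\` G k)) -integral_indic//; last exact: measurableD.
apply: ge0_le_integral_sup => x _; first by rewrite lee_fin.
rewrite lee_fin !indicE in_setD.
case: (boolP (x \in G k)) => [/set_mem/GU/mem_set ->|_] /=.
  by rewrite subrr normr0.
by case: (x \in U) => /=; rewrite sub0r normrN ger0_norm.
Qed.

(** The ramp of slope k + 1 that starts at c differs from the indicator only in the strip [S k].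
    These strips decrease to the empty set, so their measures tend to 0. *)
Let lip_set_ray (i : 'I_n) (c : R) : lip_set [set x : V | c < x ord0 i].
Proof.
pose A := [set x : V | c < x ord0 i].
have mray a b : measurable [set x : V | a < x ord0 i < b].
  rewrite (_ : [set _ | _] = (fun x : V => x ord0 i) @^-1` `]a, b[%classic).
    by rewrite -[X in measurable X]setTI; exact: measurable_coord.
  by apply/seteqP; split => x /=; rewrite in_itv.
have mA : measurable A.
  rewrite (_ : A = (fun x : V => x ord0 i) @^-1` `]c, +oo[%classic).
    by rewrite -[X in measurable X]setTI; exact: measurable_coord.
  by apply/seteqP; split => x /=; rewrite in_itv/= andbT.
split => // e e0.
pose S k := [set x : V | c < x ord0 i < c + k.+1%:R^-1].
have mS k : measurable (S k) by exact: mray.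
have : mu (S k) @[k --> \oo] --> mu (\bigcap_k S k).
  apply: nonincreasing_cvg_mu => //.
  - exact: mu_lty.
  - by apply: bigcapT_measurable => k; exact: mray.
  - move=> k l kl; apply/subsetPset => x /andP[cx xc]; apply/andP; split => //.
    apply: lt_le_trans xc _; rewrite lerD2l lef_pV2 ?posrE ?ltr0n//.
    by rewrite ler_nat.
rewrite (_ : \bigcap_k _ = set0) ?measure0; last first.
  apply/seteqP; split => // x h.
  have cx : 0 < x ord0 i - c by have /andP[] := h 0%N I; rewrite subr_gt0.
  have [k] := ltr_add_invr cx; rewrite add0r => kx.
  have /andP[_] := h k I; rewrite ltNge => /negP; apply.
  by rewrite -lerBrDl ltW.
move=> /fine_cvgP[_]/cvgrPdist_le => /(_ _ e0)[k _ /(_ k (leqnn k))] /=.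
have fin : mu (S k) \is a fin_num.
  by rewrite ge0_fin_numE//; exact: mu_lty.
rewrite sub0r normrN ger0_norm ?fine_ge0// => Sk.
pose f (x : V) := Num.min 1 (Num.max 0 (k.+1%:R * (x ord0 i - c))).
have k0 : 0 < k.+1%:R :> R by rewrite ltr0n.
exists f; split.
- by move=> x; rewrite /f /Num.min /Num.max; do 2 case: ifPn; lra.
- split.
    apply: measurable_minr => //; apply: measurable_maxr => //.
    apply: measurable_funM => //; apply: measurable_funB => //.
    exact: measurable_coord.
  exists k.+1%:R => // x y.
  apply: (@le_trans _ _ (k.+1%:R * `|x ord0 i - y ord0 i|)); last first.
    rewrite ler_pM2l//; have := coord_le_enorm (x - y) i; by rewrite !mxE.
  rewrite -[X in X * `|_|](ger0_norm (ltW k0)) -normrM.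
  have -> : k.+1%:R * (x ord0 i - y ord0 i) =
    k.+1%:R * (x ord0 i - c) - k.+1%:R * (y ord0 i - c) by lra.
  (* What remains is that clamping a real number to [0, 1] is 1-Lipschitz. *)
  rewrite /f; move: (_ * (x ord0 i - c)) (_ * (y ord0 i - c)) => u v.
  rewrite /Num.min /Num.max.
  by case: (ltP 0 u) => ?; case: (ltP 0 v) => ?; case: (ltP 1 u) => ?;
    case: (ltP 1 v) => ?; rewrite ?ltr10 ler_norml; apply/andP; split;
    case: (ger0P (u - v)) => ?; lra.
apply: (@le_trans _ _ (mu (S k))); last by rewrite -(fineK fin) lee_fin.
rewrite /L1dist -(setIT (S k)) -integral_indic//.
apply: ge0_le_integral_sup => x _; first by rewrite lee_fin.
have inP (P : V -> bool) : (x \in [set y | P y]) = P x.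
  by apply/idP/idP => [/set_mem//|Px]; exact/mem_set.
rewrite lee_fin !indicE !inP /f.
have [xc|cx] := leP (x ord0 i) c.
  rewrite /= max_l ?min_r// ?subrr ?normr0//.
  by rewrite pmulr_rle0// subr_le0.
rewrite /= max_r; last by rewrite pmulr_rge0// subr_ge0 ltW.
have [xk|xk] := ltP (x ord0 i) (c + k.+1%:R^-1).
  rewrite min_r.
    have : 0 <= k.+1%:R * (x ord0 i - c) by rewrite pmulr_rge0// subr_ge0 ltW.
    have : k.+1%:R * (x ord0 i - c) <= 1.
      by rewrite -ler_pdivlMl// mulr1 lerBlDl ltW.
    by rewrite ler_norml /= => ? ?; apply/andP; split; lra.
  by rewrite -ler_pdivlMl// mulr1 lerBlDl ltW.
rewrite min_l ?subrr ?normr0//.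
by rewrite -ler_pdivrMl// mulr1 lerBrDl.
Qed.

Lemma measurable_lip_set (A : set V) : measurable A -> lip_set A.
Proof.
move: A; suff : measurable `<=` lip_set by [].
apply: smallest_sub => /=.
  by split; [exact: lip_set0|move=> B; rewrite setTD; exact: lip_setC|].
move=> B; rewrite -bigcup_seq => -[i _ [C mC <-]] /=; rewrite setTI.
(* Passing from half-open intervals to open rays as generators of the Borel sets of the line leaves
   only [lip_set_ray] to check. *)
have : (@ocitv R).-sigma.-measurable C := mC.
rewrite RGenOInfty.measurableE; move: C {mC}.
apply: smallest_sub => /=.
  split => /=.
  - by rewrite preimage_set0; exact: lip_set0.
  - by move=> B' lB; rewrite setTD preimage_setC; exact: lip_setC.
  - by move=> F lF; rewrite preimage_bigcup; exact: lip_set_bigcup.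
move=> _ [c ->]; rewrite (_ : _ @^-1` _ = [set x : V | c < x ord0 i]) //.
by apply/seteqP; split => x /=; rewrite in_itv/= andbT.
Qed.

Definition lip_approx (g : V -> R) := measurable_fun setT g /\
  forall e : R, 0 < e -> exists2 f, lip f & (L1dist mu g f <= e%:E)%E.

Let lip_approxD f g : lip_approx f -> lip_approx g -> lip_approx (f \+ g).
Proof.
move=> [mf fe] [mg ge]; split; first exact: measurable_funD.
move=> e e0; have e20 : 0 < e / 2 by rewrite divr_gt0.
have [u lu fu] := fe _ e20; have [v lv gv] := ge _ e20.
exists (u \+ v); first exact: lipD.
rewrite (splitr e) EFinD; apply: le_trans (leeD fu gv).
rewrite /L1dist -ge0_integralD//; last 2 first.
- by apply: measurable_abs_sub => //; exact: lu.1.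
- by apply: measurable_abs_sub => //; exact: lv.1.
apply: ge0_le_integral_sup => x _; first by rewrite lee_fin.
by rewrite -EFinD lee_fin /= opprD addrACA ler_normD.
Qed.

Let lip_approxZ c g : lip_approx g -> lip_approx (fun x => c * g x).
Proof.
move=> [mg ge]; split; first exact: measurable_funM.
move=> e e0.
have c10 : 0 < `|c| + 1 by rewrite ltr_wpDl.
have [u lu gu] := ge _ (divr_gt0 e0 c10).
exists (fun x => c * u x); first exact: lipZ.
apply: (@le_trans _ _ (\int[mu]_x ((`|c| + 1)%:E * `|g x - u x|%:E))%E).
  apply: ge0_le_integral_sup => x _; first by rewrite lee_fin.
  by rewrite -EFinM lee_fin -mulrBr normrM ler_wpM2r// lerDl.
rewrite ge0_integralZl//; last by apply: measurable_abs_sub => //; exact: lu.1.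
by rewrite -lee_pdivlMl// -EFinM mulrC.
Qed.

Import HBSimple.

(** A simple function is within e/2 of [g], and a Lipschitz function within e/2 of it, by linearity
    from the case of indicators. *)
Lemma lip_dense (g : V -> R) : mu.-integrable setT (EFin \o g) -> lip_approx g.
Proof.
move=> ig; have mg : measurable_fun setT g.
  by have /measurable_EFinP := measurable_int _ ig.
split => // e e0.
have e20 : 0 < e / 2 by rewrite divr_gt0.
have [s [_ _ /fine_cvgP[fins]/cvgrPdist_le/(_ _ e20) scvg]] :=
  approximation_sfun_integrable measurableT ig.
have [k [kfin]] : exists k, L1dist mu g (s k) \is a fin_num /\
    fine (L1dist mu g (s k)) <= e / 2.
  have [k _ /(_ k (leqnn k))[]] : \forall k \near \oo,
      (\int[mu]_z `|(EFin \o g) z - (s k z)%:E|)%E \is a fin_num /\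
      `|0 - (fine (\int[mu]_z `|(EFin \o g) z - (s k z)%:E|)%E)| <= e / 2.
    by near=> k; split; near: k.
  move=> fk hk; exists k; split => //.
  by move: hk; rewrite sub0r normrN; exact/le_trans/ler_norm.
rewrite -lee_fin fineK// => gs.
have sapp : lip_approx (s k).
  (* The list holds the values of [s k]; hiding this lets the induction run over arbitrary lists. *)
  have [r ->] : exists r : seq R, (s k : V -> R) =
      fun x => \sum_(y <- r) (y * \1_(s k @^-1` [set y]) x).
    exists (finmap.enum_fset (fset_set (range (s k)))).
    by apply/funext => x; rewrite fimfunE fsbig_finite.
  elim: r => [|y r IH].
    rewrite (_ : (fun _ => _) = cst 0); last by apply/funext => x; rewrite big_nil.
    split => // e' e'0; exists (cst 0); first exact: lip_cst.
    by rewrite /L1dist integral0_eq ?lee_fin ?ltW// => x _; rewrite /= subrr normr0.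
  rewrite (_ : (fun _ => _) = (fun x => y * \1_(s k @^-1` [set y]) x) \+
     (fun x => \sum_(j <- r) j * \1_(s k @^-1` [set j]) x)); last first.
    by apply/funext => x; rewrite big_cons.
  apply: lip_approxD => //; apply: lip_approxZ; split => // e' e'0.
  have [|_ /(_ _ e'0)[f [_ lf fe]]] := @measurable_lip_set (s k @^-1` [set y]).
    exact: measurable_funPTI.
  exists f => //; apply: le_trans fe.
  by rewrite /L1dist; under eq_integral do rewrite distrC.
have [f lf sf] := sapp.2 _ e20.
exists f => //; rewrite (splitr e) EFinD.
apply: le_trans (leeD gs sf); apply: L1dist_tri => //; exact: lf.1.
Unshelve. all: end_near. Qed.

End lipschitz_density.

(** * Smooth bumps *)

Section smooth_line.
Context (R : realType).

(** One-variable counterpart of [is_Ck], with the derivative as an explicit witness, so that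
    stability under sums, products and affine substitutions goes by induction on [k]. *)
Fixpoint Ck1 (k : nat) (g : R -> R) : Prop :=
  if k is k'.+1 then
    exists2 g' : R -> R, forall x : R, is_derive x 1 g (g' x) & Ck1 k' g'
  else continuous g.

Lemma Ck1_le k g : Ck1 k.+1 g -> Ck1 k g.
Proof.
elim: k g => [|k IH] g [g' dg kg].
  by move=> x; apply/differentiable_continuous/derivable1_diffP/ex_derive.
by exists g' => //; exact: IH.
Qed.

Lemma Ck1_continuous k g : Ck1 k g -> continuous g.
Proof. by elim: k g => // k IH g /Ck1_le; exact: IH. Qed.

Lemma Ck1D k f g : Ck1 k f -> Ck1 k g -> Ck1 k (fun t => f t + g t).
Proof.
elim: k f g => [|k IH] f g; first by move=> cf cg x; apply: cvgD; [exact: cf|exact: cg].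
move=> [f' df kf] [g' dg kg]; exists (fun t => f' t + g' t); last exact: IH.
by move=> x; apply: is_deriveD.
Qed.

Lemma Ck1M k f g : Ck1 k f -> Ck1 k g -> Ck1 k (fun t => f t * g t).
Proof.
elim: k f g => [|k IH] f g; first by move=> cf cg x; apply: cvgM; [exact: cf|exact: cg].
move=> Cf Cg; have [f' df kf] := Cf; have [g' dg kg] := Cg.
exists (fun t => f t * g' t + g t * f' t); first by move=> x; apply: is_deriveM.
by apply: Ck1D; apply: IH => //; exact: Ck1_le.
Qed.

Lemma Ck1_cst k c : Ck1 k (fun=> c).
Proof.
elim: k c => [|k IH] c; first by move=> x; exact: cvg_cst.
by exists (fun=> 0) => // x; exact: is_derive_cst.
Qed.

Lemma Ck1_affine k g a b : Ck1 k g -> Ck1 k (fun t => g (a * t + b)).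
Proof.
elim: k g => [|k IH] g.
  move=> cg x; apply: continuous_comp; last exact: cg.
  by apply: cvgD; [apply: cvgM; [exact: cvg_cst|exact: cvg_id]|exact: cvg_cst].
move=> [g' dg kg]; exists (fun t => g' (a * t + b) * a); last first.
  by apply: Ck1M; [exact: IH|exact: Ck1_cst].
move=> x; apply: (@is_derive1_comp _ g (fun t => a * t + b)) => //.
have -> : (fun t => a * t + b) = (a *: (id : R -> R)) + cst b by [].
by apply: is_derive_eq; rewrite addr0 /GRing.scale/= mulr1.
Qed.

(** Settles the derivative of [flat] at the junction point 0: the difference quotient is at most C
    |h|. *)
Lemma is_derive_square_bound (f : R -> R) C : f 0 = 0 ->
  (forall t, `|f t| <= C * t ^+ 2) -> is_derive (0 : R) (1 : R) f 0.
Proof.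
move=> f0 fC.
have C0 : 0 <= C by have := fC 1; rewrite expr1n mulr1; exact: le_trans.
suff h : (fun h : R => h^-1 *: ((f \o shift 0) (h *: (1 : R)) - f 0)) @ 0^' --> (0 : R).
  by apply: DeriveDef; [apply/cvg_ex; exists 0|exact: cvg_lim].
apply/cvgrPdist_le => e e0; near=> h.
have hn0 : h != 0 by near: h; exact: nbhs_dnbhs_neq.
rewrite /= /GRing.scale/= f0 sub0r normrN subr0 addr0 mulr1 normrM normrV ?unitfE//.
rewrite ler_pdivrMl ?normr_gt0//; apply: le_trans (fC _) _.
rewrite -real_normK ?num_real// expr2 mulrA mulrC ler_wpM2l//.
have hC : `|h| <= e / (C + 1).
  near: h; apply: dnbhs0_le; rewrite divr_gt0//.
  by rewrite ltr_wpDl.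
apply: le_trans (ler_wpM2l C0 hC) _.
rewrite mulrCA ger_pMr// ler_pdivrMr ?mul1r ?lerDl//.
by rewrite ltr_wpDl.
Unshelve. all: by end_near. Qed.

(* The functions [t ^- m * exp (- 1 / t)] on [t > 0], extended by [0]: their
   span is closed under derivation. *)
Definition flat (m : nat) (t : R) : R :=
  if 0 < t then t^-1 ^+ m * expR (- t^-1) else 0.

Lemma flat_ge0 m t : 0 <= flat m t.
Proof.
rewrite /flat; case: ifPn => // t0.
by rewrite mulr_ge0 ?expR_ge0// exprn_ge0// invr_ge0 ltW.
Qed.

(** With u = 1/t, the exponential series gives exp u >= u^(m+2) / (m+2)!, that is, u^m exp(-u) <=
    (m+2)! t^2. *)
Lemma flat_le m t : `|flat m t| <= m.+2`!%:R * t ^+ 2.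
Proof.
rewrite ger0_norm ?flat_ge0// /flat; case: ifPn => [t0|_]; last first.
  by rewrite mulr_ge0 ?sqr_ge0.
have u0 : 0 < t^-1 by rewrite invr_gt0.
have := @expR_ge1Dxn R t^-1 m.+1 (ltW u0) => h.
have {h} : t^-1 ^+ m.+2 / m.+2`!%:R <= expR t^-1 by apply: le_trans h; rewrite lerDr.
rewrite ler_pdivrMr ?ltr0n ?fact_gt0// => h.
rewrite expRN -ler_pdivlMr ?invr_gt0 ?expR_gt0// invrK.
rewrite -(ler_pM2r (_ : 0 < t^-1 ^+ 2)) ?exprn_gt0//.
rewrite -exprD addn2; apply: le_trans h _.
have tt : t ^+ 2 * t^-1 ^+ 2 = 1 by rewrite -exprMn mulfV ?gt_eqF// expr1n.
rewrite [leLHS]mulrC -(mulrA _ (expR _)) [expR _ * _ ^+ 2]mulrC mulrA.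
by rewrite -(mulrA _ (t ^+ 2)) tt mulr1.
Qed.

Lemma is_derive_flat m (x : R) :
  is_derive x 1 (flat m) (- m%:R * flat m.+1 x + flat m.+2 x).
Proof.
have [x0|x0|<-] := ltgtP 0 x.
- apply: (@near_eq_is_derive _ _ _
      ((fun t : R => t^-1) ^+ m * (expR \o (fun t : R => - t^-1)))).
    near=> t; have t0 : 0 < t by near: t; exact: lt_nbhsr.
    by rewrite /flat t0 fctE exprfctE.
  have dV : is_derive x 1 (fun t : R => t^-1) (- x^-1 ^+ 2).
    have := @is_deriveV _ id x 1 1 (lt0r_neq0 x0); rewrite /GRing.scale/= mulr1 exprVn.
    by apply; exact: is_derive_id.
  have dE : is_derive x 1 (expR \o (fun t : R => - t^-1))
      (expR (- x^-1) * x^-1 ^+ 2).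
    apply: is_derive1_comp.
    by have := is_deriveN dV; rewrite opprK.
  apply: is_derive_eq.
  rewrite /flat x0 /GRing.scale/= exprfctE.
  case: m => [|m]; rewrite ?expr0 /=.
    by rewrite mul0r !mul0r ?mulr0 addr0 oppr0 mul0r add0r mul1r mulrC.
  by rewrite !exprS; lra.
- apply: (@near_eq_is_derive _ _ _ (cst 0)).
    near=> t; rewrite /flat ifF//; apply/negbTE; rewrite -leNgt ltW//.
    by near: t; exact: lt_nbhsl.
  rewrite /flat ltNge (ltW x0) /= mulr0 addr0; exact: is_derive_cst.
- rewrite {2 3}/flat ltxx mulr0 addr0.
  apply: (@is_derive_square_bound _ m.+2`!%:R); first by rewrite /flat ltxx.
  exact: flat_le.
Unshelve. all: by end_near. Qed.

Lemma Ck1_flat k m : Ck1 k (flat m).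
Proof.
elim: k m => [|k IH] m.
  move=> x; apply/differentiable_continuous/derivable1_diffP.
  by have [] := is_derive_flat m x.
exists (fun x => - m%:R * flat m.+1 x + flat m.+2 x).
  exact: is_derive_flat.
by apply: Ck1D => //; apply: Ck1M => //; exact: Ck1_cst.
Qed.

End smooth_line.

(** * Product bumps in n variables *)

Section bump.
Context (R : realType) (n : nat).
Local Notation V := 'rV[R]_n.

(** A partial derivative replaces one factor by its derivative and so stays in this family;
    smoothness then reduces to that of the factors. The constant [c] will normalise the integral. *)
Definition tensor (c : R) (g : 'I_n -> R -> R) (x : V) : R :=
  c * \prod_i g i (x ord0 i).

Lemma continuous_tensor c g : (forall i, continuous (g i)) -> continuous (tensor c g).
Proof.
move=> cg x.
apply: (@continuousM _ _ (cst c) (fun x : V => \prod_i g i (x ord0 i)) x).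
  exact: cst_continuous.
elim: (index_enum _) => [|i r IH].
  rewrite (_ : (fun _ => _) = cst 1); first exact: cst_continuous.
  by apply/funext => y; rewrite big_nil.
rewrite (_ : (fun _ => _) = (g i \o (fun y : V => y ord0 i)) *
    (fun y => \prod_(j <- r) g j (y ord0 j))).
  apply: continuousM => //; apply: continuous_comp; last exact: cg.
  exact: coord_continuous.
by apply/funext => y; rewrite big_cons.
Qed.

Definition dtensor (g : 'I_n -> R -> R) (i : 'I_n) (g' : R -> R) (j : 'I_n) :=
  if j == i then g' else g j.

Lemma is_derive_tensor c g i (g' : R -> R) x :
  (forall t : R, is_derive t 1 (g i) (g' t)) ->
  is_derive x (delta_mx ord0 i) (tensor c g) (tensor c (dtensor g i g') x).
Proof.
move=> dg; pose A := c * \prod_(j | j != i) g j (x ord0 j).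
(* Along the i-th coordinate all other factors are frozen in the constant [A], which leaves a
   one-variable derivative. *)
have tE (u : R -> R) (y : V) : (forall j, j != i -> y ord0 j = x ord0 j) ->
    tensor c (dtensor g i u) y = A * u (y ord0 i).
  move=> yx; rewrite /tensor /dtensor (bigD1 i)//= eqxx mulrCA mulrC.
  congr (c * _ * _); apply: eq_bigr => j ji; by rewrite (negbTE ji) yx.
have gE : g = dtensor g i (g i).
  by apply/funext => j; rewrite /dtensor; case: eqP => // ->.
suff h : (fun h : R => h^-1 *: ((tensor c g \o shift x) (h *: delta_mx ord0 i)
    - tensor c g x)) @ 0^' --> tensor c (dtensor g i g') x.
  by apply: DeriveDef; [apply/cvg_ex; eexists; exact: h|exact: cvg_lim].
rewrite (tE g' x)//.
have [dgi <-] := dg (x ord0 i).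
rewrite (_ : (fun h => _) = fun h : R => A *
    (h^-1 *: ((g i \o shift (x ord0 i)) (h *: (1 : R)) - g i (x ord0 i)))).
  by apply: cvgM; [exact: cvg_cst|exact: dgi].
apply/funext => h /=; rewrite {1 2}gE !tE//.
  rewrite !mxE !eqxx /= /GRing.scale/= mulr1; lra.
by move=> j ji; rewrite !mxE eqxx (negbTE ji) mulr0 add0r.
Qed.

Lemma is_Ck_tensor k c g : (forall i, Ck1 k (g i)) -> is_Ck k (tensor c g).
Proof.
elim: k c g => [|k IH] c g Cg; split => //=; try by apply: continuous_tensor => i;
  exact: Ck1_continuous (Cg i).
move=> i; have [g' dg Cg'] := Cg i; split.
  by move=> x; have [] := is_derive_tensor c x dg.
rewrite (_ : 'D_(delta_mx ord0 i) (tensor c g) = tensor c (dtensor g i g')).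
  apply: IH => j; rewrite /dtensor; case: eqP => // _.
  exact: Ck1_le.
by apply/funext => x; have [] := is_derive_tensor c x dg.
Qed.

(** One factor vanishes for t >= s and the other for t <= -s; the reflection t -> -t exchanges them,
    whence evenness. *)
Definition bump1 (s t : R) : R := flat 0 (- s^-1 * t + 1) * flat 0 (s^-1 * t + 1).

Lemma Ck1_bump1 k s : Ck1 k (bump1 s).
Proof. by apply: Ck1M; apply: Ck1_affine; exact: Ck1_flat. Qed.

Lemma bump1N s t : bump1 s (- t) = bump1 s t.
Proof. by rewrite /bump1 !mulrN !mulNr opprK mulrC. Qed.

Lemma flat0_le1 (t : R) : flat 0 t <= 1.
Proof.
rewrite /flat; case: ifPn => // t0; rewrite expr0 mul1r expR_le1.
by rewrite oppr_le0 invr_ge0 ltW.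
Qed.

Lemma bump1_ge0 s t : 0 <= bump1 s t.
Proof. by rewrite mulr_ge0 ?flat_ge0. Qed.

Lemma bump1_le1 s t : bump1 s t <= 1.
Proof. by rewrite mulr_ile1 ?flat_ge0 ?flat0_le1. Qed.

Lemma bump1_support s t : 0 < s -> bump1 s t != 0 -> - s <= t <= s.
Proof.
move=> s0; apply: contraNT; rewrite negb_and -!ltNge => /orP[ts|st].
  rewrite /bump1 [X in _ * X]/flat ifF ?mulr0//; apply/negbTE; rewrite -leNgt.
  rewrite -lerBrDr sub0r mulrC ler_pdivrMr// mulN1r ltW//.
rewrite /bump1 [X in X * _]/flat ifF ?mul0r//; apply/negbTE; rewrite -leNgt.
by rewrite mulNr addrC subr_le0 mulrC ler_pdivlMr// mul1r ltW.
Qed.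

(** Both arguments of [flat] are at least 1/2 there, and exp(-1/u) >= exp(-2) for u >= 1/2. This
    makes the integral of the bump positive. *)
Lemma bump1_gt s t : 0 < s -> `|t| <= s / 2 -> expR (- 2) ^+ 2 <= bump1 s t.
Proof.
move=> s0 ts.
have key u : 2^-1 <= u -> expR (-2) <= flat 0 u.
  move=> u2; have u0 : 0 < u by lra.
  rewrite /flat u0 expr0 mul1r ler_expR lerN2.
  by rewrite -[leRHS]invrK lef_pV2 ?posrE.
have st : `|s^-1 * t| <= 2^-1.
  by rewrite normrM gtr0_norm ?invr_gt0// ler_pdivrMl.
rewrite expr2; apply: ler_pM; rewrite ?expR_ge0//; apply: key.
  by move: st; rewrite ler_norml mulNr => /andP[? ?]; lra.
by move: st; rewrite ler_norml => /andP[? ?]; lra.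
Qed.

Lemma leb_cube (s : R) : 0 < s ->
  leb R n [set x : V | forall i, - s <= x ord0 i <= s] = ((s *+ 2) ^+ n)%:E.
Proof.
move=> s0.
have := leb_box (A := fun=> `[- s, s]%classic)
  (fun i : 'I_n => @measurable_itv R `[- s, s]).
rewrite (_ : [set x : V | _] = [set x : V | forall i, - s <= x ord0 i <= s]).
  move=> ->; rewrite (eq_bigr (fun=> (s *+ 2)%:E)); last first.
    by move=> i _; rewrite lebesgue_measure_itv/= lte_fin gt0_cp// opprK -mulr2n.
  elim: (n) => [|m IH]; first by rewrite big_ord0.
  by rewrite big_ord_recl IH -EFinM exprS.
by apply/seteqP; split => x /= h i; have := h i; rewrite /= in_itv.
Qed.

Lemma measurable_cube (s : R) : measurable [set x : V | forall i, - s <= x ord0 i <= s].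
Proof.
rewrite (_ : [set _ | _] = \bigcap_(i in [set: 'I_n])
    ((fun x : V => x ord0 i) @^-1` `[- s, s]%classic)); last first.
  by apply/seteqP; split => x /= h i; [move=> _; have := h i|have := h i I];
    rewrite /= in_itv.
apply: fin_bigcap_measurable => // i _.
by rewrite -[X in measurable X]setTI; exact: measurable_coord.
Qed.

Lemma exists_bump (d : R) : 0 < d -> exists f : V -> R,
  [/\ Cc_infty f /\ measurable_fun setT f, forall x, 0 <= f x,
      forall x, f (- x) = f x, forall x, f x != 0 -> enorm x < d &
      (\int[leb R n]_x (f x)%:E = 1)%E].
Proof.
(* A point of the cube of half-side s has squared norm at most n s^2 < (n+1)^2 s^2 = d^2. *)
move=> d0; pose s := d / n.+1%:R.
have s0 : 0 < s by rewrite divr_gt0.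
pose f0 := tensor 1 (fun=> bump1 s).
have f0_ge0 x : 0 <= f0 x.
  by rewrite /f0 /tensor mul1r prodr_ge0// => i _; exact: bump1_ge0.
have f0_le1 x : f0 x <= 1.
  rewrite /f0 /tensor mul1r; elim: (index_enum _) => [|i r IH].
    by rewrite big_nil.
  rewrite big_cons mulr_ile1 ?bump1_ge0 ?bump1_le1//.
  by rewrite prodr_ge0// => j _; exact: bump1_ge0.
have f0N0 c x : tensor c (fun=> bump1 s) x != 0 -> forall i, - s <= x ord0 i <= s.
  move=> + i; rewrite mulf_eq0 negb_or => /andP[_].
  rewrite (bigD1 i)//= mulf_eq0 negb_or.
  by move=> /andP[/(bump1_support s0)].
have mf c : measurable_fun setT (tensor c (fun=> bump1 s)).
  apply: measurable_funM => //; apply: measurable_prod => i _.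
  apply: (measurableT_comp _ (measurable_coord i)).
  by apply: continuous_measurable_fun; exact: (Ck1_continuous (Ck1_bump1 0 s)).
pose I0 := (\int[leb R n]_x (f0 x)%:E)%E.
(* The cube of half-side s bounds the integral from above and the one of half-side s/2 from below,
   so that it can be normalised to 1. *)
have I0_le : (I0 <= ((s *+ 2) ^+ n)%:E)%E.
  rewrite -leb_cube// -(setIT [set x : V | _]) -integral_indic//; last first.
    exact: measurable_cube.
  apply: ge0_le_integral_sup => x _; rewrite lee_fin// indicE.
  have [->|/f0N0 h] := eqVneq (f0 x) 0; first by [].
  by rewrite mem_set.
have I0_gt0 : (0 < I0)%E.
  have s20 : 0 < s / 2 by rewrite divr_gt0.
  pose k : R := (expR (-2) ^+ 2) ^+ n.
  have k0 : 0 < k by rewrite exprn_gt0// exprn_gt0// expR_gt0.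
  apply: (@lt_le_trans _ _ (k%:E * ((s / 2 *+ 2) ^+ n)%:E)%E).
    by rewrite -EFinM lte_fin mulr_gt0// exprn_gt0// mulrn_wgt0.
  rewrite -leb_cube// -(setIT [set x : V | _]) -integral_indic//; last first.
    exact: measurable_cube.
  rewrite -ge0_integralZl//; last 2 first.
  - by apply/measurable_EFinP/measurable_indic; exact: measurable_cube.
  - by rewrite lee_fin ltW.
  apply: ge0_le_integral_sup => x _.
    by rewrite -EFinM lee_fin mulr_ge0// ltW.
  rewrite -EFinM lee_fin indicE; case: (boolP (_ \in _)); last by rewrite mulr0.
  move=> /set_mem /= h; rewrite mulr1 /f0 /tensor mul1r.
  rewrite /k -[X in _ ^+ X](card_ord n) -prodr_const; apply: ler_prod => i _.
  by rewrite exprn_ge0 ?expR_ge0//= bump1_gt// ler_norml.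
have I0_fin : I0 \is a fin_num.
  by rewrite ge0_fin_numE ?ltW//; apply: le_lt_trans I0_le _; rewrite ltry.
pose c := (fine I0)^-1.
have c0 : 0 < c by rewrite invr_gt0 fine_gt0// I0_gt0 -ge0_fin_numE// ltW.
exists (tensor c (fun=> bump1 s)); split.
- split => //; split; first by move=> k; apply: is_Ck_tensor => i; exact: Ck1_bump1.
  have cK : compact [set x : V | forall i, `[- s, s]%classic (x ord0 i)].
    by apply: (@rV_compact _ _ (fun=> `[- s, s]%classic)) => i; exact: segment_compact.
  have clK : closed [set x : V | forall i, `[- s, s]%classic (x ord0 i)].
    by apply: compact_closed => //; exact: norm_hausdorff.
  apply: subclosed_compact cK _; first exact: closed_closure.
  rewrite [X in _ `<=` X](closure_id _).1//; apply: closure_subset.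
  by move=> x /= /f0N0 h i; rewrite in_itv /= h.
- move=> x; apply: mulr_ge0; first exact: ltW.
  by apply: prodr_ge0 => i _; exact: bump1_ge0.
- move=> x; congr (c * _); apply: eq_bigr => i _.
  by rewrite mxE bump1N.
- move=> x /f0N0 h; rewrite -(ltr_pXn2r (_ : (0 < 2)%N))// ?nnegrE ?enorm_ge0 ?ltW//.
  rewrite sqr_sqrtr; last by apply: sumr_ge0 => i _; exact: sqr_ge0.
  apply: (@le_lt_trans _ _ (\sum_(i < n) s ^+ 2)).
    apply: ler_sum => i _; rewrite -real_normK ?num_real//.
    by rewrite ler_pXn2r// ?nnegrE ?(ltW s0)// ler_norml.
  rewrite sumr_const card_ord.
  have -> : d ^+ 2 = (n.+1 ^ 2)%:R * s ^+ 2.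
    by rewrite /s exprMn exprVn natrX mulrCA mulfV ?mulr1// expf_neq0.
  rewrite -[_ *+ n]mulr_natl ltr_pM2r ?exprn_gt0// ltr_nat.
  by rewrite (@leq_trans n.+1)// expnS leq_pmulr.
- rewrite (_ : (fun x => _) = fun x => (c%:E * (f0 x)%:E)%E); last first.
    by apply/funext => x; rewrite /f0 /tensor mul1r.
  rewrite ge0_integralZl//; last 3 first.
  + by apply/measurable_EFinP; exact: mf.
  + by move=> x _; rewrite lee_fin.
  + by rewrite lee_fin ltW.
  by rewrite -/I0 -(fineK I0_fin) -EFinM mulVf// gt_eqF// -invr_gt0.
Qed.

End bump.

(** * The kernel and its mollification *)

Section kernel.
Context (R : realType) (n : nat) (n_gt0 : (0 < n)%N).
Local Notation V := 'rV[R]_n.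
Implicit Types (Omega f : V -> R).

Definition shell (a b : R) : set V := [set x | a < enorm x < b].

(* The restriction to the sphere makes the kernel measurable; it only changes
   the value at the origin. *)
Definition kern Omega (y : V) : R :=
  (Omega \_ (sphere R n)) (direction y) / enorm y ^+ n.

Lemma kernE Omega y : 0 < enorm y ->
  kern Omega y = Omega (direction y) / enorm y ^+ n.
Proof. by move=> y0; rewrite /kern patchE mem_set//; exact: sphere_direction. Qed.

Variables (Omega : V -> R).
Hypothesis iOmega : (sigma R n).-integrable (sphere R n) (EFin \o Omega).

Lemma measurable_restr : measurable_fun setT (Omega \_ (sphere R n)).
Proof.
have /measurable_EFinP mO := measurable_int _ iOmega.
by apply/(measurable_restrictT _ (@measurable_sphere R n)).
Qed.

Lemma measurable_kern : measurable_fun setT (kern Omega).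
Proof.
rewrite (_ : kern Omega = fun y => (Omega \_ (sphere R n)) (direction y) *
    (enorm y `^ (-1)) ^+ n); last first.
  by apply/funext => y; rewrite /kern powR_inv1 ?enorm_ge0// exprVn.
apply: measurable_funM.
  exact: measurableT_comp measurable_restr (@measurable_direction R n).
apply: measurable_funX.
exact: (measurableT_comp (measurable_powR (-1))) (@measurable_enorm R n).
Qed.

Lemma ge0_subset_integral_sup (mu : {measure set V -> \bar R}) (A B : set V)
    (g : V -> \bar R) : (forall x, 0 <= g x)%E -> A `<=` B ->
  (\int[mu]_(x in A) g x <= \int[mu]_(x in B) g x)%E.
Proof.
move=> g0 AB; rewrite integral_mkcond [leRHS]integral_mkcond.
apply: ge0_le_integral_sup => x _; rewrite !patchE; first by case: ifP.
case: ifPn => [/set_mem/AB/mem_set ->//|_]; by case: ifP.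
Qed.

(** On the shell |K| is at most a^(-n) |Omega| at the direction, whose integral over the ball of
    radius b is a multiple of the L^1 norm of Omega on the sphere. *)
Lemma kern_integral_lty (a b : R) : 0 < a -> 0 < b ->
  (\int[leb R n]_(y in shell a b) `|kern Omega y|%:E < +oo)%E.
Proof.
move=> a0 b0; pose O := Omega \_ (sphere R n).
have mO : measurable_fun setT (fun y => `|O y|%:E).
  apply/measurable_EFinP; apply: measurableT_comp => //; exact: measurable_restr.
have fin : (\int[sigma R n]_x `|O x|%:E < +oo)%E.
  have /integrableP[_] := iOmega; rewrite integral_mkcond; congr (_ < +oo)%E.
  apply: eq_integral => x _.
  by rewrite /O !patchE; case: ifP; rewrite //= normr0.
have h := ge0_integral_cone n_gt0 b0 mO (fun x => normr_ge0 (O x)).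
have fin0 : (\int[leb R n]_(x in shell 0 b) `|O (direction x)|%:E < +oo)%E.
  have : (n%:R%:E * \int[leb R n]_(x in shell 0 b) `|O (direction x)|%:E < +oo)%E.
    by rewrite -h lte_mul_pinfty// lee_fin exprn_ge0// ltW.
  rewrite -lte_pdivlMl ?ltr0n// gt0_muley// lte_fin invr_gt0 ltr0n//.
apply: (@le_lt_trans _ _
    (\int[leb R n]_(x in shell 0 b) ((a ^- n)%:E * `|O (direction x)|%:E))%E).
  apply: (@le_trans _ _
    (\int[leb R n]_(x in shell a b) ((a ^- n)%:E * `|O (direction x)|%:E))%E).
    apply: ge0_le_integral_sup => x; first by rewrite lee_fin.
    move=> /andP[ax _]; rewrite -EFinM lee_fin /kern normrM mulrC ler_wpM2r//.
    have x0 := lt_trans a0 ax.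
    rewrite ger0_norm ?invr_ge0 ?exprn_ge0 ?enorm_ge0//.
    by rewrite lef_pV2 ?posrE ?exprn_gt0// lerXn2r ?nnegrE ?ltW.
  apply: ge0_subset_integral_sup.
    by move=> x; rewrite -EFinM lee_fin mulr_ge0// invr_ge0 exprn_ge0// ltW.
  by move=> x /andP[ax xb]; apply/andP; split=> //; exact: lt_trans ax.
rewrite ge0_integralZl//; last 3 first.
- exact: measurable_shell.
- apply: measurable_funTS.
  exact: (measurableT_comp mO (@measurable_direction R n)).
- by rewrite lee_fin invr_ge0 exprn_ge0// ltW.
by rewrite lte_mul_pinfty// lee_fin invr_ge0 exprn_ge0// ltW.
Qed.

End kernel.

Section mollification.
Context (R : realType) (n : nat).
Local Notation V := 'rV[R]_n.

Lemma enorm_coord_bound (x : V) (b : R) : enorm x < b ->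
  forall i, - b <= x ord0 i <= b.
Proof.
move=> xb i; rewrite -ler_norml; apply: ltW; exact: le_lt_trans (coord_le_enorm x i) xb.
Qed.

Lemma leb_shell_lty (a b : R) : (leb R n (@shell R n a b) < +oo)%E.
Proof.
have [b0|b0] := leP b 0.
  rewrite (_ : shell a b = set0) ?measure0//; apply/seteqP; split => // x /andP[_ xb].
  by have := lt_le_trans xb b0; rewrite ltNge enorm_ge0.
apply: (@le_lt_trans _ _ (leb R n [set x : V | forall i, - b <= x ord0 i <= b])).
  by apply: leb_le => x /andP[_ xb]; exact: enorm_coord_bound.
by rewrite leb_cube// ltry.
Qed.

(* Cauchy-Schwarz, through the nonnegativity of [|s x + t y|^2]. *)
Lemma enormD (x y : V) : enorm (x + y) <= enorm x + enorm y.
Proof.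
have sq (z : V) : enorm z ^+ 2 = \sum_i z ord0 i ^+ 2.
  by rewrite sqr_sqrtr//; apply: sumr_ge0 => i _; exact: sqr_ge0.
have x0 := enorm_ge0 x; have y0 := enorm_ge0 y.
pose p := \sum_i x ord0 i * y ord0 i.
have cs (s t : R) : 0 <=
    s ^+ 2 * enorm x ^+ 2 + 2 * (s * t * p) + t ^+ 2 * enorm y ^+ 2.
  rewrite !sq /p !mulr_sumr -!big_split /= sumr_ge0// => i _.
  by move: (x ord0 i) (y ord0 i) => u v; have := sqr_ge0 (s * u + t * v); lra.
have z0 (z : V) : enorm z = 0 -> forall i, z ord0 i = 0.
  by move=> z0 i; apply/eqP; rewrite -normr_le0 -z0 coord_le_enorm.
have pxy : p <= enorm x * enorm y.
  have [ex|ex] := eqVneq (enorm x) 0.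
    by rewrite ex mul0r /p big1// => i _; rewrite z0// mul0r.
  have [ey|ey] := eqVneq (enorm y) 0.
    by rewrite ey mulr0 /p big1// => i _; rewrite (z0 y)// mulr0.
  have xy0 : 0 < enorm x * enorm y by rewrite mulr_gt0// lt0r ?ex ?ey.
  rewrite -(ler_pM2l xy0); have := cs (enorm y) (- enorm x); lra.
rewrite -(@ler_pXn2r _ 2)// ?nnegrE ?enorm_ge0 ?addr_ge0//.
have -> : enorm (x + y) ^+ 2 = enorm x ^+ 2 + 2 * p + enorm y ^+ 2.
  rewrite !sq /p mulr_sumr -!big_split /=; apply: eq_bigr => i _.
  by rewrite mxE; lra.
by lra.
Qed.

Lemma enormN (x : V) : enorm (- x) = enorm x.
Proof. by rewrite /enorm; under eq_bigr do rewrite mxE sqrrN. Qed.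

Lemma measurable_sub_prod :
  measurable_fun setT (fun p : V * V => p.1 - p.2).
Proof.
apply: measurable_fun_coordP => i.
rewrite (_ : (fun _ => _) = fun p : V * V => p.1 ord0 i - p.2 ord0 i); last first.
  by apply/funext => p; rewrite !mxE.
apply: measurable_funB.
  exact: (measurableT_comp (measurable_coord i) measurable_fst).
exact: (measurableT_comp (measurable_coord i) measurable_snd).
Qed.

Definition mollifier (d : R) (f : V -> R) := [/\ measurable_fun setT f,
  forall x, 0 <= f x, forall x, f (- x) = f x, forall x, f x != 0 -> enorm x < d &
  (\int[leb R n]_x (f x)%:E = 1)%E].

Section bound.
Variables (Omega : V -> R).
Hypothesis iOmega : (sigma R n).-integrable (sphere R n) (EFin \o Omega).
Variables (a b d : R) (f : V -> R).
Hypotheses (a0 : 0 < a) (da : d <= a / 2) (mof : mollifier d f).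

Let mf : measurable_fun setT f. Proof. by case: mof. Qed.
Let f0 x : 0 <= f x. Proof. by case: mof. Qed.
Let fN (x : V) : f (- x) = f x. Proof. by case: mof. Qed.
Let fd x : f x != 0 -> enorm x < d. Proof. by case: mof => _ _ _ + _; apply. Qed.
Let f1 : (\int[leb R n]_x (f x)%:E = 1)%E. Proof. by case: mof. Qed.
Let fBC (x y : V) : f (x - y) = f (y - x). Proof. by rewrite -opprB fN. Qed.

Let mfB (x : V) : measurable_fun setT (fun y : V => f (x - y)).
Proof.
rewrite (_ : (fun _ => _) = f \o (fun y : V => y - x)); last first.
  by apply/funext => y; rewrite fBC.
exact: measurableT_comp mf (measurable_shift x).
Qed.

Lemma mollifier_integral_sub (x : V) : (\int[leb R n]_y (f (x - y))%:E = 1)%E.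
Proof.
under eq_integral do rewrite fBC.
rewrite (ge0_integral_shift x (f := fun y => (f y)%:E))//.
- exact/measurable_EFinP.
Qed.

Lemma mollifier_near (x y : V) : a < enorm x -> f (x - y) != 0 -> a / 2 < enorm y.
Proof.
move=> ax fxy; have xyd : enorm (x - y) < d by exact: fd.
have : enorm x <= enorm (x - y) + enorm y.
  by have := enormD (x - y) y; rewrite subrK.
by move: (enorm (x - y)) (enorm x) (enorm y) xyd ax da => t ex ey; lra.
Qed.

Lemma mollifier_far (x y : V) : enorm x < b -> f (x - y) != 0 -> enorm y < b + a / 2.
Proof.
move=> xb fxy; have xyd : enorm (y - x) < d by rewrite -enormN opprB; exact: fd.
have : enorm y <= enorm (y - x) + enorm x.
  by have := enormD (y - x) x; rewrite subrK.
by move: (enorm (y - x)) (enorm x) (enorm y) xyd xb da => t ex ey; lra.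
Qed.

(** For |x| > a the function f(x - y) vanishes unless |y| > a/2, so all truncations with eps < a/2
    agree and the limit is eventually constant. *)
Lemma truncated_pv x : a < enorm x -> pv Omega f x = truncated Omega (a / 2) f x.
Proof.
move=> ax; rewrite /pv; apply: lim_near_cst => //.
near=> e; have ea : e < a / 2.
  by near: e; apply: nbhs_right_lt; rewrite divr_gt0.
rewrite /truncated /Rintegral; congr fine.
rewrite integral_mkcond [RHS]integral_mkcond; apply: eq_integral => y _.
rewrite !patchE; have [->|/(mollifier_near ax) ay] := eqVneq (f (x - y)) 0.
  by rewrite mulr0; case: ifP; case: ifP.
by rewrite !mem_set//=; exact: lt_trans ay.
Unshelve. all: by end_near. Qed.

(** A majorant of the error |pv - K| that is measurable in x by Tonelli, so that Chebyshev's
    inequality applies to it. *)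
Definition osc (x : V) : \bar R :=
  (\int[leb R n]_y (f (x - y) * `|kern Omega y - kern Omega x|)%:E)%E.

Lemma measurable_osc : measurable_fun setT osc.
Proof.
apply: (measurable_fun_fubini_tonelli_F (m2 := leb R n)
  (fun p : V * V => (f (p.1 - p.2) * `|kern Omega p.2 - kern Omega p.1|)%:E)).
  apply/measurable_EFinP; apply: measurable_funM.
    exact: measurableT_comp mf measurable_sub_prod.
  apply: measurableT_comp => //; apply: measurable_funB.
    exact: measurableT_comp (measurable_kern iOmega) measurable_snd.
  exact: measurableT_comp (measurable_kern iOmega) measurable_fst.
by move=> p; rewrite lee_fin mulr_ge0.
Qed.

(** Since f(x - y) has integral one in y, the error is the integral of f(x - y) (K(y) - K(x)). *)
Lemma pv_osc x : a < enorm x -> (`|pv Omega f x - kern Omega x|%:E <= osc x)%E.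
Proof.
move=> ax; rewrite truncated_pv//.
pose G (y : V) := f (x - y) * (kern Omega y - kern Omega x).
pose H (y : V) := f (x - y) * kern Omega x.
have mk := measurable_kern iOmega.
have mG : measurable_fun setT G by apply: measurable_funM => //; exact: measurable_funB.
have oscE : osc x = (\int[leb R n]_y `|(G y)%:E|)%E.
  by apply: eq_integral => y _; rewrite /= normrM (ger0_norm (f0 _)).
(* If [osc x] is infinite there is nothing to prove; otherwise [G] is integrable and the integral
   may be split. *)
have [oscy|] := ltP (osc x) +oo%E; last by move=> /(le_trans _); apply; rewrite leey.
have iG : (leb R n).-integrable setT (EFin \o G).
  apply/integrableP; split; first exact/measurable_EFinP.
  by move: oscy; rewrite oscE.
have ifB : (leb R n).-integrable setT (EFin \o (fun y : V => f (x - y))).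
  apply/integrableP; split; first exact/measurable_EFinP.
  under eq_integral do rewrite /= ger0_norm ?f0//.
  by rewrite mollifier_integral_sub ltry.
have iH : (leb R n).-integrable setT (EFin \o H).
  rewrite (_ : EFin \o H = fun y => ((f (x - y))%:E * (kern Omega x)%:E)%E)//.
  exact: integrableZr.
have HE : (\int[leb R n]_y (H y)%:E = (kern Omega x)%:E)%E.
  rewrite /H; under eq_integral do rewrite mulrC EFinM.
  by rewrite integralZl// mollifier_integral_sub mule1.
have TE : truncated Omega (a / 2) f x = fine (\int[leb R n]_y ((G y)%:E + (H y)%:E))%E.
  rewrite /truncated /Rintegral; congr fine.
  rewrite integral_mkcond; apply: eq_integral => y _.
  rewrite patchE -EFinD /G /H -mulrDr subrK.
  have [->|/(mollifier_near ax) ay] := eqVneq (f (x - y)) 0.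
    by rewrite mulr0 mul0r; case: ifP.
  rewrite mem_set//= kernE; first by rewrite mulrC.
  by apply: lt_trans ay; rewrite divr_gt0.
have Gfin : (\int[leb R n]_y (G y)%:E)%E \is a fin_num by exact: integrable_fin_num.
rewrite TE integralD// HE fineD//= addrK.
rewrite oscE -abse_EFin fineK//; apply: le_abse_integral => //.
exact/measurable_EFinP.
Qed.

End bound.

End mollification.

(** * Convergence in measure to the kernel *)

Section approximation.
Context (R : realType) (n : nat) (n_gt0 : (0 < n)%N).
Local Notation V := 'rV[R]_n.
Variables (Omega : V -> R).
Hypothesis iOmega : (sigma R n).-integrable (sphere R n) (EFin \o Omega).
Variables (a b : R) (a0 : 0 < a) (ab : a < b).

Let K := kern Omega.
Let mK : measurable_fun setT K := measurable_kern iOmega.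
Let A : set V := shell a b.
Let A' : set V := shell (a / 2) (2 * b).
Let mA : measurable A. Proof. exact: measurable_shell. Qed.
Let mA' : measurable A'. Proof. exact: measurable_shell. Qed.

(** For |x - y| < d, |K(y) - K(x)| <= |K(y) - k(y)| + L d + |k(x) - K(x)|. After averaging and
    integration over [A], the outer terms give e each and the middle one L d |A|. *)
Lemma osc_integral_le (d L e : R) (f k : V -> R) :
  d <= a / 2 -> mollifier d f -> measurable_fun setT k -> 0 <= L ->
  (forall x y, `|k x - k y| <= L * enorm (x - y)) ->
  (\int[leb R n]_(x in A') `|K x - k x|%:E <= e%:E)%E ->
  (\int[leb R n]_(x in A) osc Omega f x <= (e + e)%:E + (L * d)%:E * leb R n A)%E.
Proof.
move=> da mof mk L0 kL ke; have [mf f0 fN fd f1] := mof.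
(* A negative d would force f = 0, against its integral being one. *)
have d0 : 0 <= d.
  rewrite leNgt; apply/negP => dn.
  suff : (\int[leb R n]_x (f x)%:E = 0)%E by rewrite f1 => /eqP; rewrite onee_eq0.
  apply: integral0_eq => x _; apply/eqP; rewrite eqe; apply/negPn/negP => /fd.
  by apply/negP; rewrite -leNgt (le_trans (ltW dn))// enorm_ge0.
have ha0 := a0; have hab := ab.
have mfB (x : V) : measurable_fun setT (fun y : V => (f (x - y))%:E).
  rewrite (_ : (fun _ => _) = fun y : V => (f (y - x))%:E); last first.
    by apply/funext => y; rewrite -opprB fN.
  by apply/measurable_EFinP; exact: measurableT_comp mf (measurable_shift x).
(* For x in [A] the average only sees points y of [A'], so cutting off outside [A'] loses nothing
   and Tonelli can be used on the whole space. *)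
pose phi y := (((fun x => `|K x - k x|) \_ A') y)%:E.
have phi0 y : (0 <= phi y)%E by rewrite lee_fin patchE; case: ifP.
have mdist : measurable_fun setT (fun x => `|K x - k x|).
  by apply: measurableT_comp => //; exact: measurable_funB.
have mphi : measurable_fun setT phi.
  by apply/measurable_EFinP/(measurable_restrictT _ mA')/measurable_funTS.
have phiE : (\int[leb R n]_y phi y = \int[leb R n]_(x in A') `|K x - k x|%:E)%E.
  rewrite [RHS]integral_mkcond; apply: eq_integral => y _.
  by rewrite /phi !patchE; case: ifP.
pose P (p : V * V) := ((f (p.1 - p.2))%:E * phi p.2)%E.
have P0 p : (0 <= P p)%E by rewrite mule_ge0// lee_fin.
have mP : measurable_fun setT P.
  apply: emeasurable_funM; last exact: measurableT_comp mphi measurable_snd.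
  by apply/measurable_EFinP; exact: measurableT_comp mf (@measurable_sub_prod R n).
pose F x := (\int[leb R n]_y P (x, y))%E.
have mF : measurable_fun setT F.
  exact: (measurable_fun_fubini_tonelli_F (m2 := leb R n) P).
have F0 x : (0 <= F x)%E by exact: integral_ge0.
(* Integrating in x first, each translate of f contributes its unit mass. *)
have intF : (\int[leb R n]_x F x <= e%:E)%E.
  rewrite /F (fubini_tonelli P)//; apply: le_trans ke; rewrite -phiE.
  apply: ge0_le_integral_sup => y _; first exact: integral_ge0.
  rewrite /P /=; under eq_integral do rewrite muleC.
  rewrite ge0_integralZl//; last 2 first.
  - apply/measurable_EFinP; exact: measurableT_comp mf (measurable_shift y).
  - by move=> x _; rewrite lee_fin.
  rewrite (ge0_integral_shift y (f := fun x => (f x)%:E)).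
  - by rewrite f1 mule1.
  - exact/measurable_EFinP.
  - by move=> x; rewrite lee_fin.
apply: (@le_trans _ _ (\int[leb R n]_(x in A)
    (F x + ((L * d)%:E + `|K x - k x|%:E)))%E).
  apply: ge0_le_integral_sup => x.
    by move=> _; apply: integral_ge0 => y _; rewrite lee_fin mulr_ge0.
  move=> /andP[ax xb].
  have -> : (F x + ((L * d)%:E + `|K x - k x|%:E) =
      \int[leb R n]_y (P (x, y) + (f (x - y))%:E * (L * d + `|K x - k x|)%:E))%E.
    rewrite ge0_integralD//; last 3 first.
    - exact: (measurableT_comp mP (measurable_pair1 x)).
    - by move=> y _; rewrite mule_ge0// lee_fin// addr_ge0// mulr_ge0.
    - by apply: emeasurable_funM.
    rewrite ge0_integralZr//; last 2 first.
    - by move=> y _; rewrite lee_fin.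
    - by rewrite lee_fin addr_ge0// mulr_ge0.
    by rewrite (mollifier_integral_sub mof) mul1e.
  apply: ge0_le_integral_sup => y _; first by rewrite lee_fin mulr_ge0.
  rewrite /P /phi /= -!EFinM -EFinD lee_fin -mulrDr.
  have [->|fxy] := eqVneq (f (x - y)) 0; first by rewrite !mul0r.
  have ay := mollifier_near da mof ax fxy.
  have yb := mollifier_far da mof xb fxy.
  (* The point y lies in [A'] because b + a/2 < 2 b. *)
  rewrite ler_wpM2l// patchE mem_set; last by apply/andP; split => //; lra.
  have := kL y x; have : L * enorm (y - x) <= L * d.
    by rewrite ler_wpM2l// -enormN opprB ltW// fd.
  have := ler_distD (k y) (K y) (K x); have := ler_distD (k x) (k y) (K x).
  rewrite (distrC (k x)); rewrite /K; lra.
rewrite ge0_integralD//; last 3 first.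
- exact: measurable_funTS.
- by move=> x _; rewrite -EFinD lee_fin addr_ge0// mulr_ge0.
- apply: emeasurable_funD => //; apply: measurable_funTS; exact/measurable_EFinP.
rewrite (@ge0_integralD _ _ _ (leb R n) A mA (cst (L * d)%:E)
  (fun x => `|K x - k x|%:E))//; last 2 first.
- by move=> x _; rewrite lee_fin mulr_ge0.
- by apply: measurable_funTS; exact/measurable_EFinP.
rewrite integral_cst// EFinD addeA [X in (_ <= X)%E]addeAC; apply: leeD.
  apply: leeD => //; apply: le_trans intF; exact: ge0_subset_integral_sup.
apply: le_trans ke; apply: ge0_subset_integral_sup.
  by move=> x; rewrite lee_fin.
by move=> x /andP[ax xb]; apply/andP; split; lra.
Qed.

(** Chebyshev's inequality: the exceptional set is where [osc] exceeds eta, and the integral of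
    [osc] over [A] is made at most eta e. *)
Lemma pv_approx (eta e : R) : 0 < eta -> 0 < e -> exists2 d0 : R, 0 < d0 &
  forall d f, d <= d0 -> mollifier d f -> exists B : set V,
    [/\ measurable B, (leb R n B <= e%:E)%E &
     forall x, A x -> ~ B x -> `|pv Omega f x - K x| <= eta].
Proof.
(* A third for each of the three terms of [osc_integral_le]. *)
move=> eta0 e0; pose q := eta * e / 3.
have q0 : 0 < q by rewrite divr_gt0// mulr_gt0.
have b0 := lt_trans a0 ab.
have a20 : 0 < a / 2 by rewrite divr_gt0.
have b20 : 0 < 2 * b by rewrite mulr_gt0.
have mufin : (mrestr (leb R n) mA' setT < +oo)%E.
  by rewrite /mrestr setTI; exact: leb_shell_lty.
have iK : (mrestr (leb R n) mA').-integrable setT (EFin \o K).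
  apply/integrableP; split; first exact/measurable_EFinP.
  rewrite ge0_integral_mrestr//=; last first.
    apply/measurable_EFinP; exact: measurableT_comp.
  exact: kern_integral_lty.
have [_ /(_ _ q0)[k [mk [L L0 kL]]]] := lip_dense mufin iK.
rewrite /L1dist ge0_integral_mrestr//; last exact: measurable_abs_sub.
move=> ke.
have Afin : leb R n A \is a fin_num.
  by rewrite ge0_fin_numE//; exact: leb_shell_lty.
pose l := fine (leb R n A); have l0 : 0 <= l by exact: fine_ge0.
have Ll0 : 0 < L * l + 1 by rewrite ltr_wpDl// mulr_ge0.
(* The first bound keeps supports off the origin, the second makes L d |A| <= q; the added 1 keeps
   the denominator positive. *)
exists (Num.min (a / 2) (q / (L * l + 1))); first by rewrite lt_min a20 divr_gt0.
move=> d f; rewrite le_min => /andP[da dq] mof.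
have oscA : (\int[leb R n]_(x in A) osc Omega f x <= (eta * e)%:E)%E.
  apply: le_trans (osc_integral_le da mof mk L0 kL ke) _.
  rewrite -(fineK Afin) -/l -EFinM -EFinD lee_fin.
  have : L * d * l <= q.
    have h : (L * l + 1) * d <= q by rewrite mulrC -ler_pdivlMr.
    have [d0|d0] := leP 0 d; first by lra.
    by rewrite mulrAC; have := mulr_ge0_le0 (mulr_ge0 L0 l0) (ltW d0); lra.
  rewrite /q; lra.
have mo := measurable_osc iOmega mof.
have mB : measurable (A `&` [set x | eta%:E < osc Omega f x]%E).
  apply: emeasurable_fun_o_infty => //; exact: measurable_funTS.
exists (A `&` [set x | eta%:E < osc Omega f x]%E); split => //.
  rewrite -(lee_pmul2l (_ : eta%:E \is a fin_num)) ?lte_fin//.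
  rewrite -integral_cst// -EFinM; apply: le_trans oscA.
  have osc0 x : (0 <= osc Omega f x)%E.
    by apply: integral_ge0 => y _; rewrite lee_fin mulr_ge0//; case: mof.
  apply: (@le_trans _ _ (\int[leb R n]_(x in A `&` [set x | eta%:E < osc Omega f x]%E)
      osc Omega f x)%E).
    apply: ge0_le_integral_sup => x; first by move=> _; rewrite lee_fin ltW.
    by move=> [_ /ltW].
  by apply: ge0_subset_integral_sup => // x [].
move=> x Ax; have [ax xb] := andP Ax.
move=> /not_andP[//|/negP]; rewrite -leNgt => h; rewrite -lee_fin.
apply: le_trans h; exact: pv_osc da mof _ ax.
Qed.

End approximation.

(** * Lower bounds *)

Section lower_bound.
Context (R : realType) (n : nat) (n_gt0 : (0 < n)%N).
Local Notation V := 'rV[R]_n.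

(** If an extension exists, the chosen one satisfies [ext_pv]; otherwise the default value of [xget]
    is [pv Omega] itself. *)
Lemma T_Omega_pv (Omega f : V -> R) : Cc_infty f ->
  \forall x \ae leb R n, T_Omega Omega f x = pv Omega f x.
Proof.
move=> Cf; have [exT|nT] := pselect (exists T, continuous_extension Omega T).
  exact: ext_pv (xgetPex (pv Omega) exT) _ Cf.
rewrite /T_Omega xgetPN; last by move=> T HT; apply: nT; exists T.
exact: aeW.
Qed.

(** From F G - u v = F (G - v) + (F - u) v with |F| <= k + 1 and |v| <= k, the error is at most eta
    (2 k + 1), less than the margin 1/k. *)
Lemma product_gt1 (k eta u v F G : R) : 0 < k -> 0 < eta -> eta <= 1 ->
  eta * (2 * k + 1) < k^-1 -> `|u| <= k -> `|v| <= k -> 1 + k^-1 <= `|u * v| ->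
  `|F - u| <= eta -> `|G - v| <= eta -> 1 < `|F * G|.
Proof.
move=> k0 eta0 eta1 etak uk vk uv Fu Gv.
have Fk : `|F| <= k + 1.
  rewrite -(subrK u F); apply: le_trans (ler_normD _ _) _; lra.
have h : `|F * G - u * v| <= eta * (2 * k + 1).
  have -> : F * G - u * v = F * (G - v) + (F - u) * v by lra.
  apply: le_trans (ler_normD _ _) _; rewrite !normrM.
  have := ler_pM (normr_ge0 F) (normr_ge0 (G - v)) Fk Gv.
  have := ler_pM (normr_ge0 (F - u)) (normr_ge0 v) Fu vk.
  lra.
have := ler_normD (u * v - F * G) (F * G); rewrite subrK distrC; lra.
Qed.

Variables (Omega1 Omega2 : V -> R).
Hypothesis iO1 : (sigma R n).-integrable (sphere R n) (EFin \o Omega1).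
Hypothesis iO2 : (sigma R n).-integrable (sphere R n) (EFin \o Omega2).

Let K1 := kern Omega1.
Let K2 := kern Omega2.
Let mK1 : measurable_fun setT K1 := measurable_kern iO1.
Let mK2 : measurable_fun setT K2 := measurable_kern iO2.

(** These sets increase to {|K1 K2| > 1} off the origin and carry the uniform bounds that
    [product_gt1] needs. The outer radius k + 2 exceeds the inner one 1/(k + 1) even for k = 0. *)
Let good (k : nat) : set V := [set x | [/\ shell k.+1%:R^-1 k.+2%:R x,
  `|K1 x| <= k.+1%:R, `|K2 x| <= k.+1%:R & 1 + k.+1%:R^-1 <= `|K1 x * K2 x|]].

Let measurable_good k : measurable (good k).
Proof.
have mle (g : V -> R) c : measurable_fun setT g -> measurable [set x | g x <= c].
  move=> mg; rewrite (_ : [set x | _] = g @^-1` `]-oo, c]%classic); last first.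
    by apply/seteqP; split => x /=; rewrite in_itv.
  by rewrite -[X in measurable X]setTI; exact: mg.
have mge (g : V -> R) c : measurable_fun setT g -> measurable [set x | c <= g x].
  move=> mg; rewrite (_ : [set x | _] = g @^-1` `[c, +oo[%classic); last first.
    by apply/seteqP; split => x /=; rewrite in_itv/= andbT.
  by rewrite -[X in measurable X]setTI; exact: mg.
rewrite (_ : good k = shell k.+1%:R^-1 k.+2%:R `&` [set x | `|K1 x| <= k.+1%:R] `&`
    [set x | `|K2 x| <= k.+1%:R] `&` [set x | 1 + k.+1%:R^-1 <= `|K1 x * K2 x|]).
  apply: measurableI; last first.
    by apply: mge; apply: measurableT_comp => //; exact: measurable_funM.
  apply: measurableI; last by apply: mle; exact: measurableT_comp.
  apply: measurableI; last by apply: mle; exact: measurableT_comp.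
  exact: measurable_shell.
by apply/seteqP; split => x; [case|move=> [[[]]]].
Qed.

(** For a narrow bump f, |T1 f T2 f| > 1 on [good k] outside a set of measure at most e; then e is
    arbitrary. *)
Let leb_good (S : \bar R) k :
  (forall f, Cc_infty f -> L1 f -> L1norm f = 1%E ->
    leb R n [set x | (1 < `|T_vec Omega1 Omega2 f f x|)%R] <= S)%E ->
  (leb R n (good k) <= S)%E.
Proof.
move=> hS; apply/lee_addgt0Pr => e e0.
pose m : R := k.+1%:R; have m0 : 0 < m by rewrite ltr0n.
(* The denominator 2 m + 2, rather than 2 m + 1, yields the strict inequality [etam]. *)
pose eta : R := Num.min 1 (m^-1 / (2 * m + 2)).
have m2 : 0 < 2 * m + 2 by lra.
have eta0 : 0 < eta by rewrite lt_min ltr01 divr_gt0// invr_gt0.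
have eta1 : eta <= 1 by rewrite ge_min lexx.
have etam : eta * (2 * m + 1) < m^-1.
  apply: (@lt_le_trans _ _ (eta * (2 * m + 2))); first by rewrite ltr_pM2l//; lra.
  by rewrite -ler_pdivlMr// ge_min lexx orbT.
have e20 : 0 < e / 2 by rewrite divr_gt0.
have a0 : 0 < k.+1%:R^-1 :> R by rewrite invr_gt0.
have ab : k.+1%:R^-1 < k.+2%:R :> R.
  by rewrite (@le_lt_trans _ _ 1) ?ltr1n// invf_le1// ler1n.
have [d1 d10 h1] := pv_approx n_gt0 iO1 a0 ab eta0 e20.
have [d2 d20 h2] := pv_approx n_gt0 iO2 a0 ab eta0 e20.
have d0 : 0 < Num.min d1 d2 by rewrite lt_min d10.
(* A single bump, narrow enough for both kernels, is fed to both operators. *)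
have [f [[Cf mf] f0 fN fd f1]] := @exists_bump R n _ d0.
have mof : mollifier (Num.min d1 d2) f by [].
have [|B1 [mB1 B1e hB1]] := h1 _ _ _ mof; first by rewrite ge_min lexx.
have [|B2 [mB2 B2e hB2]] := h2 _ _ _ mof; first by rewrite ge_min lexx orbT.
have [N1 [mN1 N10 sN1]] := T_Omega_pv Omega1 Cf.
have [N2 [mN2 N20 sN2]] := T_Omega_pv Omega2 Cf.
have fabs : L1norm f = 1%E.
  by rewrite -f1; apply: eq_integral => x _; rewrite ger0_norm.
have L1f : L1 f.
  apply/integrableP; split; first exact/measurable_EFinP.
  by rewrite [X in (X < _)%E]fabs ltry.
(* Failure of approximation costs e/2 per operator; disagreement with the principal value costs a
   null set. *)
pose C := (B1 `|` N1) `|` (B2 `|` N2).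
have mC : measurable C by do ! apply: measurableU.
have leU (A B : set V) (s t : R) : measurable A -> measurable B ->
    (leb R n A <= s%:E -> leb R n B <= t%:E -> leb R n (A `|` B) <= (s + t)%:E)%E.
  move=> mA mB As Bt; apply: le_trans (measureU2 (leb R n) mA mB) _.
  by rewrite EFinD; exact: leeD.
have Ce : (leb R n C <= e%:E)%E.
  rewrite (splitr e); apply: (leU); [exact: measurableU|exact: measurableU| |].
    by rewrite -[e / 2]addr0; apply: (leU) => //; rewrite N10.
  by rewrite -[e / 2]addr0; apply: (leU) => //; rewrite N20.
have mD : measurable (good k `\` C) by exact: measurableD.
apply: (@le_trans _ _ (leb R n (good k `\` C) + leb R n C)%E).
  apply: le_trans (measureU2 (leb R n) mD mC); apply: leb_le => x gx.
  by have [Cx|Cx] := pselect (C x); [right|left].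
apply: leeD => //; apply: le_trans (hS f Cf L1f fabs).
apply: leb_le => x [[sx K1x K2x K12] Cx] /=.
have B1x : ~ B1 x by move=> ?; apply: Cx; left; left.
have B2x : ~ B2 x by move=> ?; apply: Cx; right; left.
have T1x : T_Omega Omega1 f x = pv Omega1 f x.
  by apply: contrapT => h; apply: Cx; left; right; exact: sN1.
have T2x : T_Omega Omega2 f x = pv Omega2 f x.
  by apply: contrapT => h; apply: Cx; right; right; exact: sN2.
rewrite /T_vec T1x T2x.
exact: (product_gt1 m0 eta0 eta1 etam K1x K2x K12 (hB1 _ sx B1x) (hB2 _ sx B2x)).
Qed.

Let bigcup_good :
  [set x : V | 0 < enorm x /\ 1 < `|K1 x * K2 x|] `<=` \bigcup_k good k.
Proof.
move=> x [x0 Kx]; pose q := `|K1 x * K2 x| - 1; have q0 : 0 < q by rewrite subr_gt0.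
pose M := Num.max (Num.max (enorm x) (enorm x)^-1)
  (Num.max q^-1 (Num.max `|K1 x| `|K2 x|)).
have [k] : exists k : nat, M < k.+1%:R.
  by exists (Num.truncn M); exact: truncnS_gt.
rewrite /M !gt_max => /andP[/andP[xk xVk] /andP[qk /andP[K1k K2k]]].
have k0 : 0 < k.+1%:R :> R by rewrite ltr0n.
exists k => //; split; rewrite ?ltW//.
  apply/andP; split.
    by rewrite invf_plt ?posrE.
  by apply: lt_trans xk _; rewrite ltr_nat.
have : k.+1%:R^-1 < q by rewrite invf_plt ?posrE.
by rewrite /q ltrBrDl.
Qed.

(** Continuity from below along the increasing sets [good k]. *)
Lemma kernel_product_bound (S : \bar R) :
  (forall f, Cc_infty f -> L1 f -> L1norm f = 1%E ->
    leb R n [set x | (1 < `|T_vec Omega1 Omega2 f f x|)%R] <= S)%E ->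
  (leb R n [set x : V | 0 < enorm x /\ 1 < `|K1 x * K2 x|]%R <= S)%E.
Proof.
move=> hS; apply: le_trans (leb_le bigcup_good) _.
have mU : measurable (\bigcup_k good k) by exact: bigcupT_measurable.
have nd : {homo good : k l / (k <= l)%N >-> (k <= l)%O}.
  move=> k l kl; apply/subsetPset => x [/andP[xk kx] K1x K2x K12].
  have k0 : 0 < k.+1%:R :> R by rewrite ltr0n.
  have l0 : 0 < l.+1%:R :> R by rewrite ltr0n.
  have le1 : k.+1%:R <= l.+1%:R :> R by rewrite ler_nat.
  have leV : l.+1%:R^-1 <= k.+1%:R^-1 :> R by rewrite lef_pV2 ?posrE.
  split.
  - apply/andP; split; first exact: le_lt_trans xk.
    by apply: lt_le_trans kx _; rewrite ler_nat.
  - exact: le_trans le1.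
  - exact: le_trans le1.
  - by apply: le_trans K12; rewrite lerD2l.
have cv := nondecreasing_cvg_mu (mu := leb R n) measurable_good mU nd.
rewrite -(cvg_lim _ cv)//; apply: lime_le; first exact: cvgP cv.
by apply: nearW => k; exact: leb_good.
Qed.

(** By homogeneity, |K1 K2| > 1 at x means |x|^(2n) < |Omega1 Omega2| at the direction of x, so
    [polar_lower_bound] applies to the square root of |Omega1 Omega2|. The free bound [S] stands for
    the linear norm or for the square root of the bilinear one. *)
Lemma sphere_Lhalf_bound (S : \bar R) :
  (forall f, Cc_infty f -> L1 f -> L1norm f = 1%E ->
    leb R n [set x | (1 < `|T_vec Omega1 Omega2 f f x|)%R] <= S)%E ->
  (n%:R^-1%:E * sphere_Lhalf (fun t => Omega1 t * Omega2 t)%R <= S)%E.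
Proof.
move=> /kernel_product_bound; apply: le_trans.
apply: le_trans (polar_lower_bound n_gt0
  (g := fun t => `|Omega1 t * Omega2 t| `^ 2^-1) _) _.
  by move=> x; exact: powR_ge0.
apply: leb_le => x [x0 xn]; split => //; rewrite /K1 /K2 !kernE//.
have en0 : 0 < enorm x ^+ n by rewrite exprn_gt0.
rewrite mulf_div normrM normfV (ger0_norm (ltW (mulr_gt0 en0 en0))).
rewrite ltr_pdivlMr ?mul1r ?mulr_gt0//.
apply: lt_le_trans (ltr_pM (ltW en0) (ltW en0) xn xn) _.
by rewrite -expr2 -powR_mulrn ?powR_ge0// -powRrM mulVf// powRr1.
Qed.

End lower_bound.

(** * The operator norm bounds *)

Theorem mainTheorem3 (R : realType) (n : nat) (n_gt0 : (0 < n)%N)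
    (Omega Omega1 Omega2 : 'rV[R]_n -> R)
    (LO : LlogL Omega) (LO1 : LlogL Omega1) (LO2 : LlogL Omega2)
    (O0 : mean_zero Omega) (O10 : mean_zero Omega1) (O20 : mean_zero Omega2) :
  (n%:R^-1%:E * sphere_L1norm Omega <= op_norm (T_Omega Omega))%E /\
  (n%:R^-1%:E * sphere_Lhalf (fun t => Omega1 t * Omega2 t)%R <=
     (op_norm2 (T_vec Omega1 Omega2)) `^ 2^-1)%E.
Proof.
split.
  rewrite (_ : sphere_L1norm Omega = sphere_Lhalf (fun t => Omega t * Omega t)).
    apply: (sphere_Lhalf_bound n_gt0 LO.1 LO.1) => f Cf L1f f1.
    apply: (@le_trans _ _ (weak_norm 1 (T_Omega Omega f) / L1norm f)%E); last first.
      by apply: ereal_sup_ubound; exists f => //; split => //; rewrite f1 onee_neq0.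
    rewrite f1 inve1 mule1; apply: ereal_sup_ge.
    (* The weak norm is tested at the level 1. *)
    eexists; first by exists 1; [exact: ltr01|reflexivity].
    rewrite mul1e invr1 poweRe1//; apply: leb_le => x /=.
    rewrite /T_vec normrM -expr2 => h; rewrite ltNge; apply/negP => h1.
    by move: h; rewrite ltNge exprn_ile1.
  apply: eq_integral => t _; rewrite -expr2 normrX -powR_mulrn// -powRrM mulfV//.
  by rewrite powRr1.
apply: (sphere_Lhalf_bound n_gt0 LO1.1 LO2.1) => f Cf L1f f1.
set l := leb R n _; have l0 : (0 <= l)%E by exact: measure_ge0.
(* At the level 1 the weak norm with p = 1/2 is at least l^(1/p) = l^2; the square root taken
   afterwards restores [l]. *)
have le_op : (l `^ 2 <= op_norm2 (T_vec Omega1 Omega2))%E.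
  apply: (@le_trans _ _ (weak_norm 2^-1 (T_vec Omega1 Omega2 f f) /
      (L1norm f * L1norm f))%E); last first.
    have nzf : nonzero_L1 f by split => //; rewrite f1 onee_neq0.
    by apply: ereal_sup_ubound; exists f => //; exists f.
  rewrite f1 mule1 inve1 mule1; apply: ereal_sup_ge.
  by eexists; [exists 1; [exact: ltr01|reflexivity]|rewrite mul1e invrK].
have -> : l = ((l `^ 2) `^ 2^-1)%E by rewrite -poweRrM mulfV// poweRe1.
apply: gt0_ler_poweR => //; rewrite ?in_itv/= ?leey ?andbT ?poweR_ge0//.
by apply: le_trans le_op; exact: poweR_ge0.
Qed.
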